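(* If $G$ is a CAT(0) group, then its contracting boundary $\partial_cG$ is well-defined up to $G$-equivariant homeomorphism. That is, if a group $G$ acts properly and cocompactly by isometries on two complete CAT(0) spaces $X$ and $Y$, then there is a $G$-equivariant homeomorphism $\partial_cX\to\partial_cY$, where the contracting boundaries carry the direct limit topology.
   Context: A CAT(0) group is a group acting properly, cocompactly, by isometries on a complete CAT(0) space $X$; $\partial_cG$ is defined as $\partial_cX$ for any such $X$, with $G$ acting by $g\cdot\alpha(\infty)=(g\alpha)(\infty)$. For a geodesic $\gamma$ in a CAT(0) space, $\pi_\gamma$ denotes nearest point projection onto $\gamma$. $\gamma$ is $D$-contracting if for all $x,y$, $d(x,y)<d(x,\pi_\gamma(x))$ implies $d(\pi_\gamma(x),\pi_\gamma(y))<D$; it is contracting if it is $D$-contracting for some $D$. The visual boundary $\partial X$ is the set of classes $\gamma(\infty)$ of geodesic rays, two rays being equivalent if they stay at bounded distance; each class has a unique representative starting at a given base point $x_0$. The cone topology on $\partial X$ has as neighborhood basis of $\gamma(\infty)$ (with $\gamma(0)=x_0$) the sets $\{\alpha(\infty):\alpha(0)=x_0,\ d(\alpha(t),\gamma(t))<\epsilon\ \forall t<r\}$. The contracting boundary $\partial_cX\subset\partial X$ is the set of classes of contracting rays. For $n\in\mathbb{N}$, $\partial^n_cX_{x_0}$ is the set of points represented by an $n$-contracting ray starting at $x_0$, with the subspace topology from the cone topology; the direct limit topology on $\partial_cX=\bigcup_n\partial_c^nX_{x_0}$ is the one in which $V$ is closed iff $V\cap\partial_c^nX_{x_0}$ is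 closed in $\partial_c^nX_{x_0}$ for all $n$ (independent of $x_0$). *)

(* Defs.v *)
From HB Require Import structures.
From mathcomp Require Import all_boot all_order all_algebra all_fingroup.
From mathcomp Require Import generic_quotient.
From mathcomp Require Import all_classical all_reals all_analysis.

Set Implicit Arguments.
Unset Strict Implicit.
Unset Printing Implicit Defensive.

Import Order.TTheory GRing.Theory Num.Theory.

Local Open Scope classical_set_scope.
Local Open Scope ring_scope.
Local Open Scope quotient_scope.

Section CAT0_spaces.
Context {R : realType}.

(* The norm of 'rV[R]_2 in the library is the sup norm, hence this explicit
   Euclidean distance on the plane. *)
Definition eucl_dist (u v : 'rV[R]_2) : R :=
  Num.sqrt (\sum_(i < 2) (u 0 i - v 0 i) ^+ 2).

(* Geodesic segment from x to y, parametrized on [0, 1] proportionally to arc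
   length; the values of c outside [0, 1] are irrelevant. *)
Definition geodesic_segment (X : metricType R) (c : R -> X) (x y : X) : Prop :=
  [/\ c 0 = x, c 1 = y &
      forall s t : R, 0 <= s <= 1 -> 0 <= t <= 1 ->
        mdist (c s) (c t) = `|s - t| * mdist x y].

(* (x', y', z') is a comparison triangle for (x, y, z).  Two distinct sides of
   a geodesic triangle always share a vertex, here called x, and the comparison
   inequality is trivial for two points on one side. *)
Definition CAT0 (X : metricType R) : Prop :=
  (forall x y : X, exists c : R -> X, geodesic_segment c x y) /\
  (forall (x y z : X) (c d : R -> X) (x' y' z' : 'rV[R]_2),
     geodesic_segment c x y -> geodesic_segment d x z ->
     eucl_dist x' y' = mdist x y ->
     eucl_dist x' z' = mdist x z ->
     eucl_dist y' z' = mdist y z ->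
     forall s t : R, 0 <= s <= 1 -> 0 <= t <= 1 ->
       mdist (c s) (d t) <=
         eucl_dist ((1 - s) *: x' + s *: y') ((1 - t) *: x' + t *: z')).

(* The completeness axiom of completeType, which cannot be used here as it
   comes with a pointed structure. *)
Definition complete_space (X : metricType R) : Prop :=
  forall F : set_system X, ProperFilter F -> cauchy F -> exists x : X, F --> x.

End CAT0_spaces.

Section visual_boundary.
Context {R : realType}.

(* Only the values of a ray at nonnegative times are meaningful. *)
Record ray (X : metricType R) := Ray {
  ray_fun :> R -> X ;
  ray_isom : forall s t : R, 0 <= s -> 0 <= t ->
    mdist (ray_fun s) (ray_fun t) = `|s - t| }.

HB.instance Definition _ (X : metricType R) := gen_eqMixin (ray X).
HB.instance Definition _ (X : metricType R) := gen_choiceMixin (ray X).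

Context {X : metricType R}.

Definition asymptotic (a b : ray X) : bool :=
  `[< exists K : R, forall t : R, 0 <= t -> mdist (a t) (b t) <= K >].

Lemma asymptotic_refl : reflexive asymptotic.
Proof. by move=> a; apply/asboolP; exists 0 => t _; rewrite mdistxx. Qed.

Lemma asymptotic_sym : symmetric asymptotic.
Proof.
move=> a b; apply/asboolP/asboolP => -[K abK];
  by exists K => t t0; rewrite metric_sym abK.
Qed.

Lemma asymptotic_trans : transitive asymptotic.
Proof.
move=> b a c /asboolP[K abK] /asboolP[L bcL]; apply/asboolP.
exists (K + L) => t t0; apply: le_trans (metric_triangle _ (b t) _) _.
by rewrite lerD ?abK ?bcL.
Qed.

Canonical asymptotic_equiv :=
  EquivRel asymptotic asymptotic_refl asymptotic_sym asymptotic_trans.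

Definition boundary : Type := {eq_quot asymptotic_equiv}.
HB.instance Definition _ := Choice.on boundary.

(* endpoint a is the class a(oo) *)
Definition endpoint (a : ray X) : boundary := \pi_({eq_quot asymptotic_equiv}) a.

Lemma endpointP (a b : ray X) : endpoint a = endpoint b <-> asymptotic a b.
Proof. by split => [/eqquotP|ab]; last exact/eqquotP. Qed.

Lemma endpoint_surj (xi : boundary) : exists a : ray X, endpoint a = xi.
Proof. by exists (repr (xi : {eq_quot asymptotic_equiv})); exact: reprK. Qed.

End visual_boundary.
Arguments boundary {R} X.

Section cone_topology.
Context {R : realType} {X : metricType R}.

Definition cone_nbhd (c : ray X) (r e : R) : set (boundary X) :=
  [set endpoint a | a in [set a : ray X | a 0 = c 0 /\
     forall t : R, 0 <= t < r -> mdist (a t) (c t) < e]].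

(* The boundary, with the cone topology based at x0. *)
Definition cone_boundary (x0 : X) : Type := boundary X.
HB.instance Definition _ (x0 : X) := Choice.on (cone_boundary x0).

(* In a complete CAT(0) space every boundary point is the endpoint of a ray
   issuing from x0, so that the condition bears on all points of U. *)
Definition cone_open (x0 : X) (U : set (cone_boundary x0)) : Prop :=
  forall c : ray X, c 0 = x0 -> U (endpoint c) ->
    exists r e : R, [/\ 0 < r, 0 < e & cone_nbhd c r e `<=` U].

Lemma cone_openT (x0 : X) : cone_open [set: cone_boundary x0].
Proof. by move=> c _ _; exists 1, 1. Qed.

Lemma cone_nbhdS (c : ray X) (r r' e e' : R) : r' <= r -> e <= e' ->
  cone_nbhd c r e `<=` cone_nbhd c r' e'.
Proof.
move=> rr ee _ [a [a0 ac] <-]; exists a => //; split=> // t /andP[t0 tr].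
by apply: lt_le_trans ee; rewrite ac// t0 (lt_le_trans tr).
Qed.

Lemma cone_openI (x0 : X) : setI_closed (@cone_open x0).
Proof.
move=> U V oU oV c c0 [/(oU c c0)[r [e [r0 e0 sU]]]].
move=> /(oV c c0)[r' [e' [r'0 e'0 sV]]].
exists (Num.max r r'), (Num.min e e'); split.
- by rewrite lt_max r0.
- by rewrite lt_min e0.
- move=> xi cxi; split; [apply: sU|apply: sV]; apply: cone_nbhdS cxi.
  + by rewrite le_max lexx.
  + by rewrite ge_min lexx.
  + by rewrite le_max lexx orbT.
  + by rewrite ge_min lexx orbT.
Qed.

Lemma cone_open_bigU (x0 : X) (I : Type) (f : I -> set (cone_boundary x0)) :
  (forall i, cone_open (f i)) -> cone_open (\bigcup_i f i).
Proof.
move=> fo c c0 [i _ /(fo i c c0)[r [e [r0 e0 s]]]].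
by exists r, e; split=> // xi /s fxi; exists i.
Qed.

HB.instance Definition _ (x0 : X) := isOpenTopological.Build (cone_boundary x0)
  (@cone_openT x0) (@cone_openI x0) (@cone_open_bigU x0).

Lemma open_cone_boundaryE (x0 : X) (U : set (cone_boundary x0)) :
  open U = cone_open U.
Proof. by []. Qed.

End cone_topology.

Section contracting_boundary.
Context {R : realType} {X : metricType R}.

Definition nearest_times (c : ray X) (x : X) : set R :=
  [set s | 0 <= s /\ forall t, 0 <= t -> mdist x (c s) <= mdist x (c t)].

(* In a CAT(0) space nearest_times c x is a singleton, so that the default
   value of xget plays no role. *)
Definition proj (c : ray X) (x : X) : X := c (xget 0 (nearest_times c x)).

Definition D_contracting (D : R) (c : ray X) : Prop :=
  forall x y : X, mdist x y < mdist x (proj c x) ->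
    mdist (proj c x) (proj c y) < D.

Definition contracting (c : ray X) : Prop := exists D : R, D_contracting D c.

Definition contracting_points : set (boundary X) :=
  [set endpoint c | c in contracting].

Definition contracting_stratum (x0 : X) (n : nat) : set (cone_boundary x0) :=
  [set endpoint c | c in [set c : ray X | c 0 = x0 /\ D_contracting n%:R c]].
Arguments contracting_stratum x0 n : clear implicits.

(* The contracting boundary, with the direct limit topology based at x0. *)
Definition cboundary (x0 : X) : Type := contracting_points.
HB.instance Definition _ (x0 : X) := Choice.on (cboundary x0).

Definition cboundary_val (x0 : X) (xi : cboundary x0) : cone_boundary x0 :=
  set_val xi.

(* C is a closed set of the cone topology cutting the same subset as V out of
   the n-th stratum. *)
Definition limit_closed (x0 : X) (V : set (cboundary x0)) : Prop :=
  forall n : nat, exists2 C : set (cone_boundary x0), closed C &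
    (@cboundary_val x0 @` V) `&` contracting_stratum x0 n =
    C `&` contracting_stratum x0 n.

Definition limit_open (x0 : X) (U : set (cboundary x0)) : Prop :=
  limit_closed (~` U).

Lemma cboundary_val_inj (x0 : X) : injective (@cboundary_val x0).
Proof. by move=> xi eta; exact: val_inj. Qed.

Lemma contracting_stratum_sub (x0 : X) (n : nat) :
  contracting_stratum x0 n `<=` range (@cboundary_val x0).
Proof.
move=> _ [c [_ cn] <-].
have cc : endpoint c \in contracting_points.
  by apply/mem_set; exists c => //; exists n%:R.
by exists (SigSub cc).
Qed.

Lemma limit_openT (x0 : X) : limit_open [set: cboundary x0].
Proof. by move=> n; exists set0; [exact: closed0|rewrite setCT image_set0]. Qed.

Lemma limit_openI (x0 : X) : setI_closed (@limit_open x0).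
Proof.
move=> U V oU oV n; have [C cC UC] := oU n; have [D cD VD] := oV n.
exists (C `|` D); first exact: closedU.
by rewrite setCI image_setU !setIUl UC VD.
Qed.

Lemma limit_open_bigU (x0 : X) (I : Type) (f : I -> set (cboundary x0)) :
  (forall i, limit_open (f i)) -> limit_open (\bigcup_i f i).
Proof.
move=> fo n.
have /choice[C CP] (i : I) : exists C : set (cone_boundary x0), closed C /\
    (@cboundary_val x0 @` (~` f i)) `&` contracting_stratum x0 n =
    C `&` contracting_stratum x0 n.
  by have [C cC fC] := fo i n; exists C.
exists (\bigcap_i C i); first by apply: closed_bigI => i _; exact: (CP i).1.
apply/seteqP; split => [_ [[xi fxi <-] Sxi]|xi [Cxi Sxi]]; split => //.
- move=> i _.
  suff [] : (C i `&` contracting_stratum x0 n) (cboundary_val xi) by [].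
  by rewrite -(CP i).2; split => //; exists xi => // fi; apply: fxi; exists i.
- have [eta _ etaxi] := contracting_stratum_sub Sxi.
  exists eta => // -[i _ fi].
  have : (C i `&` contracting_stratum x0 n) xi by split => //; exact: Cxi.
  rewrite -(CP i).2 => -[[zeta fz]]; rewrite -etaxi => /cboundary_val_inj zE _.
  by apply: fz; rewrite zE.
Qed.

HB.instance Definition _ (x0 : X) := isOpenTopological.Build (cboundary x0)
  (@limit_openT x0) (@limit_openI x0) (@limit_open_bigU x0).

Lemma closed_cboundaryP (x0 : X) (V : set (cboundary x0)) :
  closed V <-> limit_closed V.
Proof.
rewrite -openC; have -> : open (~` V) = limit_open (~` V) by [].
by rewrite /limit_open setCK.
Qed.

End contracting_boundary.
Arguments contracting_stratum {R X} x0 n.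

Definition homeomorphism (S T : topologicalType) (f : S -> T) : Prop :=
  continuous f /\
  exists h : T -> S, [/\ cancel f h, cancel h f & continuous h].

Section actions.
Context {R : realType}.

Record isometric_action (G : groupType) (X : metricType R) := IsometricAction {
  act :> G -> X -> X ;
  act1 : forall x : X, act 1%g x = x ;
  actM : forall (g h : G) (x : X), act (g * h)%g x = act g (act h x) ;
  act_isom : forall (g : G) (x y : X), mdist (act g x) (act g y) = mdist x y }.

Context {G : groupType} {X : metricType R} (A : isometric_action G X).

(* Properness in the sense of Bridson and Haefliger. *)
Definition proper_action : Prop :=
  forall x : X, exists2 r : R, 0 < r &
    finite_set [set g : G | (A g @` ball x r) `&` ball x r !=set0].

Definition cocompact_action : Prop :=
  exists2 K : set X, compact K & \bigcup_(g in [set: G]) (A g @` K) = [set: X].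

Lemma ray_act_subproof (g : G) (c : ray X) (s t : R) : 0 <= s -> 0 <= t ->
  mdist (A g (c s)) (A g (c t)) = `|s - t|.
Proof. by move=> s0 t0; rewrite act_isom ray_isom. Qed.

Definition ray_act (g : G) (c : ray X) : ray X :=
  Ray (@ray_act_subproof g c).

Definition boundary_act (g : G) (xi : boundary X) : boundary X :=
  endpoint (ray_act g (repr (xi : {eq_quot asymptotic_equiv}))).

Lemma boundary_act_endpoint (g : G) (c : ray X) :
  boundary_act g (endpoint c) = endpoint (ray_act g c).
Proof.
apply/endpointP/asboolP.
have /endpointP/asboolP[K cK] : endpoint
    (repr (endpoint c : {eq_quot asymptotic_equiv})) = endpoint c.
  exact: reprK.
by exists K => t t0; rewrite /= act_isom cK.
Qed.

Lemma proj_ray_act (g : G) (c : ray X) (x : X) :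
  proj (ray_act g c) (A g x) = A g (proj c x).
Proof.
rewrite /proj /=; congr (A g (c (xget 0 _))).
apply/seteqP; split=> s [s0 sc]; split=> // t t0; have := sc t t0;
  by rewrite /= !act_isom.
Qed.

Lemma contracting_ray_act (g : G) (c : ray X) :
  contracting c -> contracting (ray_act g c).
Proof.
have AVK (x : X) : A g (A g^-1%g x) = x by rewrite -actM mulgV act1.
move=> [D cD]; exists D => x y; rewrite -(AVK x) -(AVK y) !proj_ray_act.
move: (A g^-1%g x) (A g^-1%g y) => {}x {}y; rewrite !act_isom; exact: cD.
Qed.

Lemma boundary_act_contracting (g : G) (xi : boundary X) :
  xi \in contracting_points -> boundary_act g xi \in contracting_points.
Proof.
move=> /set_mem[c cc <-]; apply/mem_set; rewrite boundary_act_endpoint.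
by exists (ray_act g c) => //; exact: contracting_ray_act.
Qed.

Definition cboundary_act (x0 : X) (g : G) (xi : cboundary x0) : cboundary x0 :=
  SigSub (boundary_act_contracting g (valP xi)).

End actions.

(* Main.v *)
Require Import Defs.
From HB Require Import structures.
From mathcomp Require Import all_boot all_order all_algebra all_fingroup.
From mathcomp Require Import all_classical all_reals all_analysis.
From mathcomp Require Import ring lra zify.


(* A coarse inverse pair of maps between CAT(0) spaces does not respect nearest
   point projections, not even up to a bounded error, so the contraction
   property cannot be transported directly.  What can be transported is the Morse
   property: outside a large neighbourhood of a contracting ray the projection to
   the ray moves slowly compared with any path, hence a quasi-geodesic with
   endpoints near the ray cannot make a long excursion.  Consequently the
   geodesics from y0 to the image of a contracting ray c stay close to that image
   and converge to a ray c'.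

   To see that c' is contracting, let p be the projection of x to c', let q be a
   point of c' and z the point of [x, q] nearest to p.  The path p, z, q is a
   quasi-geodesic, so z is close to c'.  Put h = d(p, z) and go up from p and z by
   t, a small multiple of h, along [p, x] and [z, x].  As d(x, z) <= d(x, p), both
   new points and the segment between them, of length at most h, lie in the ball
   of radius d(x, p) - t about x, hence at distance at least t from c'.  Seen from
   c, this is a path far from c whose projection covers about h: this bounds h.
   Thus [x, q] passes near p, and in a CAT(0) space this slimness gives back the
   contraction property.

   All constants depend only on the contraction constant of c, so that the
   boundary map sends each stratum into a stratum; it is continuous there for the
   cone topology, since rays which are close at a large time have images which
   are close at a large time, and distances between rays are convex.  Finally,
   orbit maps provide a coarsely equivariant coarse inverse pair. *)

Set Implicit Arguments.
Unset Strict Implicit.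
Unset Printing Implicit Defensive.

Import Order.TTheory GRing.Theory Num.Theory.
Import numFieldNormedType.Exports.

Local Open Scope classical_set_scope.
Local Open Scope ring_scope.

Local Notation proj := Defs.proj.

(** * Comparison inequalities in CAT(0) spaces *)

Section CAT0_geometry.
Context {R : realType}.

Lemma sqr_eucl_dist (u v : 'rV[R]_2) :
  eucl_dist u v ^+ 2 =
    (u 0 0 - v 0 0) ^+ 2 + (u 0 (lift 0 0) - v 0 (lift 0 0)) ^+ 2.
Proof.
rewrite sqr_sqrtr; last by apply: sumr_ge0 => i _; exact: sqr_ge0.
by rewrite !big_ord_recl big_ord0 addr0.
Qed.

Definition plane_point (a b : R) : 'rV[R]_2 :=
  \row_(i < 2) if i == 0 then a else b.

Lemma sqr_eucl_dist_plane_point (a b a' b' : R) :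
  eucl_dist (plane_point a b) (plane_point a' b') ^+ 2 =
  (a - a') ^+ 2 + (b - b') ^+ 2.
Proof. by rewrite sqr_eucl_dist !mxE. Qed.

Lemma eucl_dist_ge0 (u v : 'rV[R]_2) : 0 <= eucl_dist u v.
Proof. exact: sqrtr_ge0. Qed.

Lemma sqr_eq_ge0 (x y : R) : 0 <= x -> 0 <= y -> x ^+ 2 = y ^+ 2 -> x = y.
Proof. by move=> x0 y0 /eqP; rewrite eqrXn2// => /eqP. Qed.

(** Coordinates of a Euclidean triangle [(0, 0)], [(a, 0)], [(u, v)]: the first equation is the law
    of cosines, and [b ^+ 2 - u ^+ 2] is nonnegative by Heron's factorization, whose factors are
    triangle inequalities. *)
Lemma comparison_triangle (a b e : R) : 0 <= a -> 0 <= b -> 0 <= e ->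
    a <= b + e -> b <= a + e -> e <= a + b ->
  exists u v : R, u * a *+ 2 = a ^+ 2 + b ^+ 2 - e ^+ 2 /\
    u ^+ 2 + v ^+ 2 = b ^+ 2.
Proof.
move=> a0 b0 e0 abe bae eab.
have [a_eq0|an0] := eqVneq a 0.
  exists b, 0; have -> : b = e by lra.
  by rewrite a_eq0; split; ring.
have ap : 0 < a by rewrite lt_def an0.
pose u := (a ^+ 2 + b ^+ 2 - e ^+ 2) / (a *+ 2).
have ua : u * a *+ 2 = a ^+ 2 + b ^+ 2 - e ^+ 2.
  by rewrite /u; field.
exists u, (Num.sqrt (b ^+ 2 - u ^+ 2)); split => //.
rewrite sqr_sqrtr; first by ring.
have : 0 <= (b ^+ 2 - u ^+ 2) * (a *+ 2) ^+ 2.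
  have -> : (b ^+ 2 - u ^+ 2) * (a *+ 2) ^+ 2 =
     (a + b + e) * (a + b - e) * ((a + e - b) * (b + e - a)).
    by transitivity ((b * a *+ 2) ^+ 2 - (u * a *+ 2) ^+ 2); [|rewrite ua]; ring.
  by rewrite !mulr_ge0//; lra.
by rewrite pmulr_lge0// exprn_gt0// pmulrn_lgt0.
Qed.

Context {X : metricType R}.
Implicit Types x y z p : X.

(** The comparison inequality freed of the plane: the comparison points are expanded in coordinates,
    which the law of cosines then turns into side lengths. *)
Lemma CAT0_cosine x y z (c d : R -> X) (s t : R) : CAT0 X ->
    geodesic_segment c x y -> geodesic_segment d x z ->
    0 <= s <= 1 -> 0 <= t <= 1 ->
  mdist (c s) (d t) ^+ 2 <= s ^+ 2 * mdist x y ^+ 2 + t ^+ 2 * mdist x z ^+ 2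
    - s * t * (mdist x y ^+ 2 + mdist x z ^+ 2 - mdist y z ^+ 2).
Proof.
move=> [_ cat] cxy dxz s01 t01.
set a := mdist x y; set b := mdist x z; set e := mdist y z.
have [u [v [uE vE]]] : exists u v : R,
    u * a *+ 2 = a ^+ 2 + b ^+ 2 - e ^+ 2 /\ u ^+ 2 + v ^+ 2 = b ^+ 2.
  apply: comparison_triangle; rewrite ?mdist_ge0//.
  - by rewrite /e metric_sym metric_triangle.
  - exact: metric_triangle.
  - by rewrite /a metric_sym metric_triangle.
have dE (p q : 'rV[R]_2) (r : R) : 0 <= r -> eucl_dist p q ^+ 2 = r ^+ 2 ->
    eucl_dist p q = r by move=> r0; apply: sqr_eq_ge0; rewrite ?eucl_dist_ge0.
have : mdist (c s) (d t) <=
    eucl_dist ((1 - s) *: plane_point 0 0 + s *: plane_point a 0)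
      ((1 - t) *: plane_point 0 0 + t *: plane_point u v).
  apply: (cat x y z) => //; apply: dE; rewrite ?mdist_ge0// sqr_eucl_dist_plane_point.
  - by rewrite -/a; ring.
  - by rewrite -/b -vE; ring.
  - rewrite -/e.
    have -> : (a - u) ^+ 2 + (0 - v) ^+ 2 =
      a ^+ 2 - u * a *+ 2 + (u ^+ 2 + v ^+ 2) by ring.
    by rewrite uE vE; ring.
rewrite -(ler_sqr (mdist_ge0 _ _) (eucl_dist_ge0 _ _)).
move=> /le_trans; apply; rewrite sqr_eucl_dist !mxE/=.
rewrite -uE -vE.
rewrite le_eqVlt; apply/orP; left; apply/eqP; ring.
Qed.

Lemma geodesic_segment_dist_start (c : R -> X) x y (s : R) :
  geodesic_segment c x y -> 0 <= s <= 1 -> mdist x (c s) = s * mdist x y.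
Proof.
move=> [c0 c1 cE] s01; rewrite -[in LHS]c0 cE ?lexx ?ler01//.
by rewrite sub0r normrN ger0_norm//; case/andP: s01.
Qed.

Lemma geodesic_segment_dist_end (c : R -> X) x y (s : R) :
  geodesic_segment c x y -> 0 <= s <= 1 -> mdist (c s) y = (1 - s) * mdist x y.
Proof.
move=> [c0 c1 cE] s01; rewrite -[in LHS]c1 cE ?lexx ?ler01//.
by rewrite distrC ger0_norm// subr_ge0; case/andP: s01.
Qed.

Lemma geodesic_segment_rev (c : R -> X) x y :
  geodesic_segment c x y -> geodesic_segment (fun s => c (1 - s)) y x.
Proof.
move=> [c0 c1 cE]; split; rewrite ?subr0 ?subrr// => s t s01 t01.
rewrite cE; [|lra..].
rewrite (metric_sym y) opprB distrC; congr (`|_| * _); ring.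
Qed.

Lemma geodesic_segment_sub (c : R -> X) x y (s : R) :
  geodesic_segment c x y -> 0 <= s <= 1 ->
  geodesic_segment (fun t => c (t * s)) x (c s).
Proof.
move=> cxy s01; have [c0 c1 cE] := cxy; split; rewrite ?mul0r ?mul1r// => t u t01 u01.
have le01 (v : R) : 0 <= v <= 1 -> 0 <= v * s <= 1.
  by move=> v01; rewrite mulr_ge0/= ?mulr_ile1//; lra.
rewrite cE ?le01// (geodesic_segment_dist_start cxy)// -mulrBl normrM.
by rewrite (ger0_norm (_ : 0 <= s)) ?mulrA//; lra.
Qed.

(** [CAT0_cosine] at the vertex [y] with second parameter 1; equality in the plane is Stewart's
    theorem. *)
Lemma CAT0_stewart (c : R -> X) y z p (s : R) : CAT0 X ->
    geodesic_segment c y z -> 0 <= s <= 1 ->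
  mdist p (c s) ^+ 2 <= (1 - s) * mdist p y ^+ 2 + s * mdist p z ^+ 2
    - s * (1 - s) * mdist y z ^+ 2.
Proof.
move=> X0 cyz s01; have [d dyp] := X0.1 y p.
have := CAT0_cosine X0 cyz dyp s01 (_ : 0 <= 1 <= 1).
rewrite lexx ler01 => /(_ isT); have [_ -> _] := dyp.
rewrite metric_sym (metric_sym y p) (metric_sym z p) => /le_trans; apply.
by rewrite le_eqVlt; apply/orP; left; apply/eqP; ring.
Qed.

Lemma CAT0_dist_convex (c : R -> X) y z p (s r : R) : CAT0 X ->
    geodesic_segment c y z -> 0 <= s <= 1 -> mdist p y <= r ->
    mdist p z <= r -> mdist p (c s) <= r.
Proof.
move=> X0 cyz s01 yr zr.
have r0 : 0 <= r by apply: le_trans yr; exact: mdist_ge0.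
rewrite -(ler_sqr (mdist_ge0 _ _) r0).
apply: le_trans (CAT0_stewart p X0 cyz s01) _.
have := mdist_ge0 p y; have := mdist_ge0 p z; have := mdist_ge0 y z.
move: (mdist p y) (mdist p z) (mdist y z) yr zr => a b e ar br e0 b0 a0.
have ? : a ^+ 2 <= r ^+ 2 by rewrite ler_sqr.
have ? : b ^+ 2 <= r ^+ 2 by rewrite ler_sqr.
have ? : 0 <= s * (1 - s) * e ^+ 2.
  by rewrite !mulr_ge0 ?sqr_ge0//; lra.
have ? : (1 - s) * a ^+ 2 <= (1 - s) * r ^+ 2 by rewrite ler_wpM2l//; lra.
have ? : s * b ^+ 2 <= s * r ^+ 2 by rewrite ler_wpM2l//; lra.
lra.
Qed.

Lemma CAT0_fan (c d : R -> X) x y z (s : R) : CAT0 X ->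
    geodesic_segment c x y -> geodesic_segment d x z ->
    0 <= s <= 1 -> mdist (c s) (d s) <= s * mdist y z.
Proof.
move=> X0 cxy dxz s01; have s0 : 0 <= s by case/andP: s01.
rewrite -ler_sqr ?nnegrE ?mulr_ge0 ?mdist_ge0//.
apply: le_trans (CAT0_cosine X0 cxy dxz s01 s01) _.
by rewrite le_eqVlt; apply/orP; left; apply/eqP; ring.
Qed.

Lemma CAT0_cofan (c d : R -> X) x y z (s : R) : CAT0 X ->
    geodesic_segment c y x -> geodesic_segment d z x ->
    0 <= s <= 1 -> mdist (c s) (d s) <= (1 - s) * mdist y z.
Proof.
move=> X0 /geodesic_segment_rev cyx /geodesic_segment_rev dzx s01.
have := CAT0_fan X0 cyx dzx (_ : 0 <= 1 - s <= 1).
by rewrite !subKr; apply; lra.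
Qed.

(** The diagonal [e] cuts the quadrilateral into two triangles, one for [CAT0_cofan] and one for
    [CAT0_fan]. *)
Lemma CAT0_convex (c d : R -> X) x y x' y' (s : R) : CAT0 X ->
    geodesic_segment c x y -> geodesic_segment d x' y' -> 0 <= s <= 1 ->
  mdist (c s) (d s) <= (1 - s) * mdist x x' + s * mdist y y'.
Proof.
move=> X0 cxy dxy s01; have [e exy] := X0.1 x y'.
apply: le_trans (metric_triangle _ (e s) _) _.
by rewrite addrC lerD//; [exact: (CAT0_cofan X0 exy)|exact: (CAT0_fan X0 cxy)].
Qed.

(* z is the point of the segment nearest to p, hence the angle at z is not
   acute. *)
Lemma CAT0_obtuse (c : R -> X) z x p : CAT0 X -> geodesic_segment c z x ->
    (forall s, 0 <= s <= 1 -> mdist p z <= mdist p (c s)) ->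
  mdist z x <= mdist p x.
Proof.
move=> X0 czx near_z; set l := mdist z x; set a := mdist p x.
have l0 : 0 <= l by exact: mdist_ge0.
have a0 : 0 <= a by exact: mdist_ge0.
(* Stewart's inequality at [c s], divided by [s]; the claim is the limit as [s] tends to 0. *)
have H (s : R) : 0 < s -> s <= 1 -> (1 - s) * l ^+ 2 <= a ^+ 2.
  move=> s0 s1; have s01 : 0 <= s <= 1 by rewrite ltW.
  have := CAT0_stewart p X0 czx s01; rewrite -/l -/a.
  have : mdist p z ^+ 2 <= mdist p (c s) ^+ 2.
    by rewrite ler_sqr ?nnegrE ?mdist_ge0// near_z.
  move=> h1 h2.
  have : 0 <= s * (a ^+ 2 - (1 - s) * l ^+ 2 - mdist p z ^+ 2) by lra.
  by rewrite pmulr_rge0//; have := sqr_ge0 (mdist p z); lra.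
rewrite -ler_sqr//; apply/ler_addgt0Pl => e e0.
have l1 : 0 < l ^+ 2 + e by rewrite ltr_wpDl// sqr_ge0.
have := H (e / (l ^+ 2 + e)); rewrite divr_gt0// ler_pdivrMr// mul1r lerDr sqr_ge0.
move=> /(_ isT isT).
have : (e / (l ^+ 2 + e)) * l ^+ 2 <= e.
  rewrite mulrAC ler_pdivrMr//; apply: ler_wpM2l; first exact: ltW.
  by rewrite lerDl ltW.
lra.
Qed.

Lemma complete_cauchy_seq (u : nat -> X) : complete_space X ->
    (forall e, 0 < e -> exists N, forall m n, (N <= m)%N -> (N <= n)%N ->
       mdist (u m) (u n) < e) ->
  exists l, forall e, 0 < e -> exists N, forall n, (N <= n)%N -> mdist (u n) l < e.
Proof.
move=> Xc uC.
have [] := Xc (u @ \oo).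
  apply/cauchy_exP => e e0; have [N NP] := uC e e0.
  exists (u N); exists N => // n /= Nn.
  by rewrite ballEmdist/=; exact: NP.
move=> l /metricType_numDomainType.cvgrPdist_lt ul.
exists l => e e0; have [N _ NP] := ul e e0.
by exists N => n Nn; rewrite metric_sym; exact: NP.
Qed.

End CAT0_geometry.

(** * Contracting rays *)

Section rays.
Context {R : realType}.

(** Clamping the argument to [[a, b]] gives a Lipschitz function on the whole line, to which the
    extreme value theorem applies. *)
Lemma lipschitz_min (u : R -> R) (a b k : R) : a <= b -> 0 <= k ->
    (forall s t, a <= s <= b -> a <= t <= b -> `|u s - u t| <= k * `|s - t|) ->
  exists2 s, a <= s <= b & forall t, a <= t <= b -> u s <= u t.
Proof.
move=> ab k0 lip; pose clamp (s : R) := if s < a then a else if b < s then b else s.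
have clampP s : a <= clamp s <= b.
  by rewrite /clamp; case: (ltP s a) => ?; case: (ltP b s) => ?; lra.
have clampE s : a <= s <= b -> clamp s = s.
  by rewrite /clamp; case: (ltP s a) => ?; case: (ltP b s) => ?; lra.
have clamp_lip s t : `|clamp s - clamp t| <= `|s - t|.
  rewrite /clamp; case: (ltP s a) => ?; case: (ltP b s) => ?;
    case: (ltP t a) => ?; case: (ltP b t) => ?; rewrite ler_norml;
    have := ler_norm (s - t); have := ler_norm (t - s);
    rewrite (distrC t s); lra.
have uc : continuous (u \o clamp : R -> R).
  move=> s; apply/cvgrPdist_lt => e e0; near=> t.
  apply: le_lt_trans (lip _ _ _ _) _ => //.
  apply: le_lt_trans (_ : k * `|s - t| < _).
    by rewrite ler_wpM2l.
  (* [k] may vanish, and the next step divides by this factor. *)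
  apply: le_lt_trans (_ : (k + 1) * `|s - t| < _).
    by rewrite ler_wpM2r//; lra.
  rewrite mulrC -ltr_pdivlMr; last by lra.
  near: t; apply: cvgr_dist_lt => //; rewrite divr_gt0//; lra.
have [s] := @EVT_min R (u \o clamp) a b ab (continuous_subspaceT uc).
rewrite in_itv/= => sab smin; exists s => // t tab.
by have := smin t; rewrite in_itv/= !clampE//; exact.
Unshelve. all: by end_near. Qed.

Context {X : metricType R}.
Implicit Types (c : ray X) (x y z p : X).

Lemma mdist_lipschitz p x y : `|mdist p x - mdist p y| <= mdist x y.
Proof.
have := metric_triangle p x y; have := metric_triangle p y x.
by rewrite (metric_sym y x) ler_norml; lra.
Qed.

Definition near_ray (E : R) c x : Prop := exists2 s : R, 0 <= s & mdist x (c s) <= E.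

Lemma near_ray_close (E E' : R) c x y : near_ray E c x -> mdist x y + E <= E' ->
  near_ray E' c y.
Proof.
move=> [s s0 sE] h; exists s => //.
have := metric_triangle y x (c s); rewrite (metric_sym y x); lra.
Qed.

(** After time [2 d(x, c 0)] the ray is farther from [x] than [c 0] is, so a minimum over a compact
    interval is global. *)
Lemma nearest_times_nonempty c x : exists s, nearest_times c x s.
Proof.
have d0 := mdist_ge0 x (c 0).
have [|||s s0 smin] := @lipschitz_min (fun s => mdist x (c s)) 0 (mdist x (c 0) *+ 2) 1.
- by lra.
- by [].
- move=> s t s0 t0; apply: le_trans (mdist_lipschitz _ _ _) _.
  by rewrite ray_isom ?mul1r//; lra.
exists s; split; first by lra.
move=> t t0; have [tT|Tt] := leP t (mdist x (c 0) *+ 2).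
  by apply: smin; rewrite t0.
have := smin 0; rewrite lexx => /(_ _)/le_trans; apply; first by lra.
have := metric_triangle (c 0) x (c t).
rewrite ray_isom// sub0r normrN ger0_norm// (metric_sym (c 0)); lra.
Qed.

Lemma projP c x : exists2 s, 0 <= s & proj c x = c s /\
  forall t, 0 <= t -> mdist x (proj c x) <= mdist x (c t).
Proof.
have [/= s0 smin] := xgetPex 0 (nearest_times_nonempty c x).
by rewrite /proj; exists (xget 0 (nearest_times c x)).
Qed.

Lemma near_ray_proj (E : R) c x : near_ray E c x <-> mdist x (proj c x) <= E.
Proof.
have [s s0 [sE smin]] := projP c x; split.
  by move=> [t t0]; apply: le_trans; exact: smin.
by rewrite sE => xE; exists s.
Qed.

Lemma path_length (w : nat -> X) (n : nat) (r : R) :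
    (forall i, (i < n)%N -> mdist (w i) (w i.+1) <= r) ->
  mdist (w 0%N) (w n) <= n%:R * r.
Proof.
elim: n => [_|n IHn wr]; first by rewrite mdistxx mul0r.
apply: le_trans (metric_triangle _ (w n) _) _.
rewrite -natr1 mulrDl mul1r lerD ?wr// IHn// => i ilt.
by rewrite wr// ltnS ltnW.
Qed.

(** Each step stays in a ball disjoint from the ray, centred at one of its two ends. The choice of
    the end admits an excursion that starts and finishes near the ray: its first step is seen from
    its second point. *)
Lemma contracting_path (D : R) c (w : nat -> X) (n : nat) : D_contracting D c ->
    (forall i, (i < n)%N -> mdist (w i) (w i.+1) < mdist (w i) (proj c (w i)) \/
       mdist (w i) (w i.+1) < mdist (w i.+1) (proj c (w i.+1))) ->
  mdist (proj c (w 0%N)) (proj c (w n)) <= n%:R * D.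
Proof.
move=> cD wfar; apply: (@path_length (fun i => proj c (w i))) => i /wfar[|] h.
  exact/ltW/cD.
by rewrite metric_sym; apply/ltW/cD; rewrite metric_sym.
Qed.

(** During an excursion from [w a] to [w b] outside the [r]-neighbourhood, the projection moves by
    at most [D] per step, while [w] advances by [D + 1] per step up to the error [e]. Hence
    [b - a <= 2 r + e], and each step is shorter than [r]. *)
Lemma discrete_morse (D r e : R) c (w : nat -> X) (n : nat) :
    D_contracting D c ->
    (forall i j, (i <= j)%N -> (j <= n)%N ->
       (j - i)%:R * (D + 1) - e <= mdist (w i) (w j)) ->
    (forall i, (i < n)%N -> mdist (w i) (w i.+1) < r) ->
    near_ray r c (w 0%N) -> near_ray r c (w n) ->
  forall i, (i <= n)%N -> near_ray (r + (r *+ 2 + e) * r) c (w i).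
Proof.
move=> cD wqi wr near0 nearn i le_in.
have e0 : 0 <= e.
  by have := wqi 0%N 0%N (leqnn _) (leq0n _); rewrite mdistxx subnn mul0r; lra.
have r0 : 0 <= r by have [s _] := near0; apply: le_trans; exact: mdist_ge0.
pose close k := mdist (w k) (proj c (w k)) <= r.
have [ci|nci] := boolP (close i).
  apply/near_ray_proj; apply: le_trans ci _.
  by rewrite lerDl mulr_ge0// addr_ge0// mulrn_wge0.
(* [a] is the last index up to [i] that is close to the ray, [b] the first one from [i] on. *)
have exa : exists k, (k <= i)%N && close k.
  by exists 0%N; rewrite leq0n; exact/near_ray_proj.
have ltki k : (k <= i)%N && close k -> (k <= i)%N by case/andP.
case: (ex_maxnP exa ltki) => a /andP[ai ca] amax.
have exb : exists k, [&& (i <= k)%N, (k <= n)%N & close k].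
  by exists n; rewrite le_in leqnn; exact/near_ray_proj.
case: (ex_minnP exb) => b /and3P[ib bn cb] bmin.
have {}ai : (a < i)%N.
  by rewrite ltn_neqAle ai andbT; apply: contraNneq nci => <-.
have {}ib : (i < b)%N.
  by rewrite ltn_neqAle ib andbT; apply: contraNneq nci => ->.
have far k : (a < k)%N -> (k < b)%N -> r < mdist (w k) (proj c (w k)).
  move=> ak kb; rewrite ltNge; apply/negP => ck.
  have [ki|ik] := leqP k i.
    by have := amax k; rewrite ki /close ck => /(_ isT); rewrite leqNgt ak.
  have := bmin k; rewrite (ltnW ik) /close ck (leq_trans (ltnW kb))//.
  by move=> /(_ isT); rewrite leqNgt kb.
have step k : (k < b - a)%N -> mdist (w (a + k)%N) (w (a + k.+1)%N) < r.
  by move=> kba; rewrite addnS wr// (leq_trans _ bn)// -ltn_subRL.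
have hw : mdist (proj c (w a)) (proj c (w b)) <= (b - a)%:R * D.
  have := @contracting_path D c (fun k => w (a + k)%N) (b - a) cD.
  rewrite addn0 subnKC; last exact/ltnW/(ltn_trans ai).
  apply => k kba; case: k kba => [|k] kba.
    by right; apply: lt_trans (step _ kba) _; apply: far; lia.
  by left; apply: lt_trans (step _ kba) _; apply: far; lia.
have hab : mdist (w a) (w b) <= r + (b - a)%:R * D + r.
  apply: le_trans (metric_triangle _ (proj c (w a)) _) _.
  rewrite -addrA lerD//.
  apply: le_trans (metric_triangle _ (proj c (w b)) _) _.
  by rewrite lerD// metric_sym.
have := wqi a b (ltnW (ltn_trans ai ib)) bn => hba.
have {}hba : (b - a)%:R <= r *+ 2 + e by lra.
have hai : mdist (w a) (w i) <= (i - a)%:R * r.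
  have := @path_length (fun k => w (a + k)%N) (i - a) r.
  rewrite addn0 subnKC; last exact/ltnW.
  by apply => k kia; apply/ltW/step; lia.
apply: (@near_ray_close r _ c (w a)); first exact/near_ray_proj.
rewrite addrC lerD2l; apply: le_trans hai _; apply: ler_wpM2r => //.
by apply: le_trans hba; rewrite ler_nat; lia.
Qed.

Lemma ray_segment c (u : R) : 0 <= u ->
  geodesic_segment (fun s => c (s * u)) (c 0) (c u).
Proof.
move=> u0; split; rewrite ?mul0r ?mul1r// => s t /andP[s0 _] /andP[t0 _].
rewrite !ray_isom ?mulr_ge0// -mulrBl normrM sub0r normrN.
by rewrite (ger0_norm (_ : 0 <= u)).
Qed.

Lemma ray_dist_convex (a b : ray X) (t u : R) : CAT0 X -> 0 < u -> 0 <= t <= u ->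
  mdist (a t) (b t) <= mdist (a 0) (b 0) + t / u * mdist (a u) (b u).
Proof.
move=> X0 u0 tu; have tu01 : 0 <= t / u <= 1.
  by rewrite divr_ge0 ?ler_pdivrMr ?mul1r//; lra.
have := CAT0_convex X0 (ray_segment a (ltW u0)) (ray_segment b (ltW u0)) tu01.
rewrite divfK ?gt_eqF// => /le_trans; apply; rewrite lerD2r.
by rewrite ler_piMl ?mdist_ge0//; lra.
Qed.

(** Convexity carries a bound at a large time back to all earlier times. *)
Lemma asymptotic_unbounded (a b : ray X) (K : R) : CAT0 X ->
    (forall T : R, exists2 t, T <= t & mdist (a t) (b t) <= K) ->
  asymptotic a b.
Proof.
move=> X0 abK; apply/asboolP; exists (mdist (a 0) (b 0) + K) => t t0.
have [u tu uK] := abK (t + 1); have u0 : 0 < u by lra.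
have tu' : 0 <= t <= u by lra.
apply: le_trans (ray_dist_convex a b X0 u0 tu') _; rewrite lerD2l.
apply: le_trans uK; rewrite ler_piMl ?mdist_ge0// ler_pdivrMr// mul1r; lra.
Qed.

(** The distance is convex, starts at 0 and is bounded by some [K], so at time [t] it is at most
    [t / u * K] for arbitrarily large [u]. *)
Lemma asymptotic_eq (a b : ray X) (t : R) : CAT0 X -> a 0 = b 0 ->
  asymptotic a b -> 0 <= t -> a t = b t.
Proof.
move=> X0 ab0 /asboolP[K abK] t0; apply: mdist_positivity; apply/eqP.
rewrite eq_le mdist_ge0 andbT; apply/ler_addgt0Pr => e e0; rewrite add0r.
have K0 : 0 <= K by apply: le_trans (abK 0 _); rewrite ?mdist_ge0.
have tKe : 0 <= t * K / e by rewrite divr_ge0 ?mulr_ge0//; exact: ltW.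
(* A time [u >= t] so large that [t / u * K <= e]. *)
have u0 : 0 < t + 1 + t * K / e by lra.
have tu : 0 <= t <= t + 1 + t * K / e by lra.
apply: le_trans (ray_dist_convex a b X0 u0 tu) _.
rewrite ab0 mdistxx add0r mulrAC ler_pdivrMr//.
apply: le_trans (_ : t * K <= _); first by rewrite ler_wpM2l// abK// ltW.
rewrite mulrDr mulrCA divff ?gt_eqF// mulr1 lerDr mulr_ge0 ?ltW//; lra.
Qed.

End rays.

(** * Coarse inverses and the Morse property *)

Section coarse.
Context {R : realType}.
Implicit Types L D E T : R.

Definition coarse_lipschitz L (X Y : metricType R) (f : X -> Y) : Prop :=
  forall x x', mdist (f x) (f x') <= L * mdist x x' + L.

(** A quasi-isometry with a chosen quasi-inverse, symmetric in the two maps; a single constant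
    serves for all the bounds. *)
Definition coarse_inverse L (X Y : metricType R) (f : X -> Y) (g : Y -> X) : Prop :=
  [/\ 1 <= L, coarse_lipschitz L f, coarse_lipschitz L g,
      forall x, mdist (g (f x)) x <= L & forall y, mdist (f (g y)) y <= L].

Lemma coarse_inverse_sym L (X Y : metricType R) (f : X -> Y) (g : Y -> X) :
  coarse_inverse L f g -> coarse_inverse L g f.
Proof. by case. Qed.

(** [f] undoes [g] up to [L], so the Lipschitz bound of [f] bounds [g] from below. *)
Lemma coarse_inverse_lower L (X Y : metricType R) (f : X -> Y) (g : Y -> X) y y' :
  coarse_inverse L f g -> mdist y y' <= L * mdist (g y) (g y') + L * 3.
Proof.
move=> [L1 fL gL gf fg].
have := metric_triangle y (f (g y)) y'.
have := metric_triangle (f (g y)) (f (g y')) y'.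
have := fL (g y) (g y'); have := fg y; have := fg y'.
rewrite (metric_sym y (f (g y))); lra.
Qed.

(** The constant 3 is the one that [concat_quasi_geodesic] yields. *)
Definition quasi_geodesic3 (X : metricType R) (b : R -> X) T : Prop :=
  forall u v, 0 <= u -> u <= v -> v <= T ->
    v - u <= 3 * mdist (b u) (b v) /\ mdist (b u) (b v) <= v - u.

(** [discrete_morse] for [g \o b] sampled at multiples of [k]. The bound [M] precedes the spaces and
    maps, so it depends on [L], [D] and [E] only. *)
Lemma morse L D E : 0 <= D -> 0 <= E -> exists2 M, 0 <= M &
  forall (X Y : metricType R) (f : X -> Y) (g : Y -> X) (c : ray X)
    (b : R -> Y) T, coarse_inverse L f g -> D_contracting D c -> 0 <= T ->
  quasi_geodesic3 b T -> near_ray E c (g (b 0)) -> near_ray E c (g (b T)) ->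
  forall u, 0 <= u <= T -> near_ray M c (g (b u)).
Proof.
(* Samples at parameter distance [k] are [k / 3] apart, which [g] reduces to [D + 1] up to an error.
   In [e], the summand [D + 1] pays for a shorter last step and 3 for the additive error of
   [coarse_inverse_lower]; [r] exceeds both [E] and the length of a step. *)
move=> D0 E0; pose k := 3 * L * (D + 1).
pose r := L * k + L + 1 + E; pose e := D + 1 + 3.
(* The absolute value gives [0 <= M] before [1 <= L] is available. *)
exists (`|r + (r *+ 2 + e) * r + (L * k + L)|) => //.
move=> X Y f g c b T fg cD T0 bT near0 nearT.
have [L1 _ gL _ _] := fg.
have k0 : 0 < k by rewrite !mulr_gt0//; lra.
have Lk0 : 0 < L * k by rewrite mulr_gt0//; lra.
have r0 : 0 < r by rewrite /r; lra.
(* With this [n] the cut-off at [T] makes [t n = T]; the last step may be shorter than [k], whence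
   the loss of one [k] in [tmono]. *)
pose n := (Num.truncn (T / k)).+1.
pose t (i : nat) := Num.min (i%:R * k) T.
have Tn : n.-1%:R * k <= T < n%:R * k.
  have /truncn_itv/andP[] : 0 <= T / k by rewrite divr_ge0// ltW.
  by rewrite ler_pdivlMr// ltr_pdivrMr// => -> ->.
have tik i : 0 <= t i /\ t i <= T.
  by rewrite /t le_min T0 ge_min lexx orbT mulr_ge0// ltW.
have tE i : (i < n)%N -> t i = i%:R * k.
  move=> ilt; rewrite /t min_l//; case/andP: Tn => + _; apply: le_trans.
  by rewrite ler_pM2r// ler_nat; lia.
have tn : t n = T by rewrite /t min_r//; case/andP: Tn => _ /ltW.
have tmono i j : (i <= j)%N -> (j <= n)%N ->
    t j - t i <= (j - i)%:R * k /\ (j - i)%:R * k - k <= t j - t i.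
  rewrite leq_eqVlt => /orP[/eqP -> _|ij jn].
    by rewrite subnn subrr mul0r; split; lra.
  have ti := tE i (leq_trans ij jn).
  have tj : t j <= j%:R * k by rewrite /t ge_min lexx.
  rewrite natrB ?(ltnW ij)// ti; split; first by rewrite mulrBl; lra.
  suff : j%:R * k - k <= t j by lra.
  move: jn; rewrite leq_eqVlt => /orP[/eqP ->|/tE ->]; last by lra.
  rewrite tn; case/andP: Tn => + _; apply: le_trans.
  by rewrite -[in leLHS]/(n.-1.+1%:R * k - k) -natr1 mulrDl mul1r addrK.
have t_le i j : (i <= j)%N -> t i <= t j.
  move=> ij; rewrite /t le_min !ge_min lexx orbT andbT; apply/orP; left.
  by rewrite ler_pM2r// ler_nat.
have t0 : t 0%N = 0 by rewrite tE// mul0r.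
have L0 : 0 < L by lra.
have wqi i j : (i <= j)%N -> (j <= n)%N ->
    (j - i)%:R * (D + 1) - e <= mdist (g (b (t i))) (g (b (t j))).
  move=> ij jn; have [_ h1] := tmono i j ij jn.
  have [h2 _] := bT (t i) (t j) (tik i).1 (t_le i j ij) (tik j).2.
  have h3 := coarse_inverse_lower (b (t i)) (b (t j)) fg.
  rewrite -(ler_pM2l L0); move: h1; rewrite /e /k; lra.
have wr i : (i < n)%N -> mdist (g (b (t i))) (g (b (t i.+1))) < r.
  move=> ilt; have [h1 _] := tmono i i.+1 (leqnSn i) ilt.
  have [_ h2] := bT (t i) (t i.+1) (tik i).1 (t_le i i.+1 (leqnSn i)) (tik _).2.
  apply: le_lt_trans (gL _ _) _.
  have : L * mdist (b (t i)) (b (t i.+1)) <= L * k.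
    rewrite ler_pM2l//; move: h1; rewrite subSnn mul1r; lra.
  by rewrite /r; lra.
have nr x : near_ray E c x -> near_ray r c x.
  by move=> /(@near_ray_close _ _ _ r _ _ x); apply; rewrite mdistxx /r; lra.
have near := @discrete_morse _ _ D r e c (fun i => g (b (t i))) n cD wqi wr.
rewrite t0 tn in near.
move=> u /andP[u0 uT].
pose i := Num.truncn (u / k).
have /andP[iu ui] : i%:R * k <= u < i.+1%:R * k.
  have /truncn_itv/andP[] : 0 <= u / k by rewrite divr_ge0// ltW.
  by rewrite ler_pdivlMr// ltr_pdivrMr// => -> ->.
have ilt : (i < n)%N.
  rewrite -(ltr_nat R) -(ltr_pM2r k0); case/andP: Tn => _; apply: le_lt_trans.
  exact: le_trans iu uT.
apply: near_ray_close (near (nr _ near0) (nr _ nearT) i (ltnW ilt)) _.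
have [_ h2] : u - t i <= 3 * mdist (b (t i)) (b u) /\ mdist (b (t i)) (b u) <= u - t i.
  by apply: bT => //; [exact: (tik i).1|rewrite tE].
have h3 := gL (b (t i)) (b u).
have : L * mdist (b (t i)) (b u) <= L * k.
  rewrite ler_pM2l//; move: h2 ui; rewrite tE// -natr1; lra.
have := ler_norm (r + (r *+ 2 + e) * r + (L * k + L)); lra.
Qed.

End coarse.

(** * Slimness and contraction *)

Section contraction_transfer.
Context {R : realType}.
Implicit Types L D E T : R.

Section concatenation.
Context {X : metricType R}.
Implicit Types x y z p q : X.

Lemma geodesic_segment_tail (c : R -> X) x y (s : R) :
  geodesic_segment c x y -> 0 <= s <= 1 ->
  geodesic_segment (fun t => c (s + t * (1 - s))) (c s) y.
Proof.
move=> cxy s01.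
have s01' : 0 <= 1 - s <= 1 by lra.
have := geodesic_segment_rev
  (geodesic_segment_sub (geodesic_segment_rev cxy) s01').
rewrite subKr; congr (geodesic_segment _ _ _).
by apply/funext => t; congr c; ring.
Qed.

(** Arc length parametrization; when [x = y], division by 0 gives 0 and the arc is constant. *)
Definition arc (c : R -> X) x y (u : R) : X := c (u / mdist x y).

Lemma arc_start (c : R -> X) x y : geodesic_segment c x y -> arc c x y 0 = x.
Proof. by move=> [c0 _ _]; rewrite /arc mul0r. Qed.

Lemma arc_end (c : R -> X) x y : geodesic_segment c x y ->
  arc c x y (mdist x y) = y.
Proof.
move=> [c0 c1 _]; rewrite /arc; have [xy0|xy0] := eqVneq (mdist x y) 0.
  by rewrite xy0 mul0r c0; exact: mdist_positivity.
by rewrite divff.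
Qed.

Lemma arc_isom (c : R -> X) x y u v : geodesic_segment c x y ->
    0 <= u <= mdist x y -> 0 <= v <= mdist x y ->
  mdist (arc c x y u) (arc c x y v) = `|u - v|.
Proof.
move=> [c0 c1 cE] ul vl; rewrite /arc.
have [xy0|xy0] := eqVneq (mdist x y) 0.
  have [-> ->] : u = 0 /\ v = 0 by move: ul vl; rewrite xy0; split; lra.
  by rewrite mdistxx subrr normr0.
have l0 : 0 < mdist x y by rewrite lt_def xy0 mdist_ge0.
rewrite cE; last 2 first.
- by rewrite divr_ge0 ?ler_pdivrMr ?mul1r//; lra.
- by rewrite divr_ge0 ?ler_pdivrMr ?mul1r//; lra.
by rewrite -mulrBl normrM normfV (gtr0_norm l0) divfK.
Qed.

Lemma arc_dist_start (c : R -> X) x y u : geodesic_segment c x y ->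
  0 <= u <= mdist x y -> mdist x (arc c x y u) = u.
Proof.
move=> cxy ul; have l0 := mdist_ge0 x y.
have := arc_isom cxy (u := 0) (v := u); rewrite arc_start// => ->; last 2 first.
- by rewrite lexx.
- by [].
by rewrite distrC subr0 ger0_norm//; lra.
Qed.

Lemma arc_dist_end (c : R -> X) x y u : geodesic_segment c x y ->
  0 <= u <= mdist x y -> mdist (arc c x y u) y = mdist x y - u.
Proof.
move=> cxy ul; have l0 := mdist_ge0 x y.
have := arc_isom cxy (u := u) (v := mdist x y); rewrite arc_end// => ->; last 2 first.
- by [].
- by rewrite lexx andbT.
by rewrite distrC ger0_norm//; lra.
Qed.

(** Let [b u] come before [z] at distance [w] from it, and [b v] after [z]. As [b v] is no nearer to
    [p] than [z], one has [w <= d(b u, b v)]; then [d(z, b v) <= w + d(b u, b v)], and [v - u] is at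
    most three times [d(b u, b v)]. *)
Lemma concat_quasi_geodesic (c d : R -> X) p z q :
    geodesic_segment c p z -> geodesic_segment d z q ->
    (forall s, 0 <= s <= 1 -> mdist p z <= mdist p (d s)) ->
  exists b : R -> X, let T := mdist p z + mdist z q in
    [/\ quasi_geodesic3 b T, b 0 = p, b T = q & b (mdist p z) = z].
Proof.
move=> cpz dzq near_z.
have h0 := mdist_ge0 p z; have l0 := mdist_ge0 z q.
exists (fun u => if u <= mdist p z then arc c p z u
  else arc d z q (u - mdist p z)).
split; last 3 first.
- by rewrite h0 arc_start.
- case: ifPn => [hl|_]; last by rewrite addrAC subrr add0r arc_end.
  have l00 : mdist z q = 0 by lra.
  by rewrite l00 addr0 arc_end//; exact: mdist_positivity.
- by rewrite lexx arc_end.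
move=> u v u0 uv vT.
have [uh|hu] := leP u (mdist p z); have [vh|hv] := leP v (mdist p z).
- by rewrite (arc_isom cpz); [rewrite distrC ger0_norm; (try split); lra|lra..].
- have d1 : mdist (arc c p z u) z = mdist p z - u.
    by apply: arc_dist_end => //; lra.
  have d2 : mdist z (arc d z q (v - mdist p z)) = v - mdist p z.
    by apply: arc_dist_start => //; lra.
  have d3 : mdist p (arc c p z u) = u by apply: arc_dist_start => //; lra.
  have d4 : mdist p z <= mdist p (arc d z q (v - mdist p z)).
    apply: near_z; have [l00|l00] := eqVneq (mdist z q) 0.
      by rewrite l00 invr0 mulr0 lexx ler01.
    have lp : 0 < mdist z q by rewrite lt_def l00.
    by rewrite divr_ge0 ?ler_pdivrMr ?mul1r//; lra.
  have := metric_triangle (arc c p z u) z (arc d z q (v - mdist p z)).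
  have := metric_triangle z (arc c p z u) (arc d z q (v - mdist p z)).
  have := metric_triangle p (arc c p z u) (arc d z q (v - mdist p z)).
  by rewrite (metric_sym z (arc c p z u)); split; lra.
- lra.
- by rewrite (arc_isom dzq); [rewrite distrC ger0_norm; (try split); lra|lra..].
Qed.

Lemma nearest_on_segment (c : R -> X) x y p : geodesic_segment c x y ->
  exists2 s, 0 <= s <= 1 & forall t, 0 <= t <= 1 -> mdist p (c s) <= mdist p (c t).
Proof.
move=> [_ _ cE]; apply: (@lipschitz_min _ _ 0 1 (mdist x y)) => //; first exact: mdist_ge0.
move=> s t s01 t01; apply: le_trans (mdist_lipschitz _ _ _) _.
by rewrite cE// mulrC.
Qed.

Definition slim (d : R) (c : ray X) : Prop :=
  forall x (v : R) (e : R -> X), 0 <= v -> geodesic_segment e x (c v) ->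
  exists2 s, 0 <= s <= 1 & mdist (proj c x) (e s) <= d.

(* If p and q are the projections of x and y and are far apart, [x, q] passes
   near p and [p, y] passes near q, so that the angle at q between x and y is
   obtuse and d(x, y) >= d(x, q) >= d(x, p). *)
Lemma slim_contracting (d : R) (c : ray X) : CAT0 X -> 0 < d -> slim d c ->
  D_contracting (d * 20) c.
Proof.
move=> X0 d0 sl x y xy_lt; rewrite ltNge; apply/negP => pq_ge.
have [tp tp0 [pE xmin]] := projP c x; have [tq tq0 [qE ymin]] := projP c y.
set p := proj c x in pE xmin pq_ge xy_lt *; set q := proj c y in qE ymin pq_ge *.
have [e exq] := X0.1 x q; have [e' eyp] := X0.1 y p.
have [s s01 ps] : exists2 s, 0 <= s <= 1 & mdist p (e s) <= d.
  by apply: sl tq0 _; rewrite -qE.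
have [t t01 qt] : exists2 t, 0 <= t <= 1 & mdist q (e' t) <= d.
  by apply: sl tp0 _; rewrite -pE.
have xq_ge : mdist x p <= mdist x q by rewrite qE; exact: xmin.
have st := CAT0_stewart y X0 exq s01.
have d1 := geodesic_segment_dist_end exq s01.
have d2 := geodesic_segment_dist_start exq s01.
have d3 := geodesic_segment_dist_start eyp t01.
have d4 := geodesic_segment_dist_end eyp t01.
have t1 := metric_triangle x (e s) p; have t2 := metric_triangle p (e s) q.
have t3 := metric_triangle x y q; have t4 := metric_triangle q (e' t) p.
have t5 := metric_triangle y (e' t) q; have t6 := metric_triangle y (e s) p.
have t7 := metric_triangle (e s) p q.
rewrite (metric_sym (e s) p) in t1 t6 t7.
rewrite (metric_sym (e' t) q) in t5; rewrite (metric_sym q p) in t4.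
have h0 := mdist_ge0 x y.
move: st d1 d2 d3 d4 t1 t2 t3 t4 t5 t6 t7 pq_ge ps qt xq_ge xy_lt h0.
rewrite (metric_sym y x).
move: (mdist x y) (mdist x p) (mdist x q) (mdist p q) (mdist y q) (mdist y p)
 (mdist y (e s)) (mdist x (e s)) (mdist (e s) q) (mdist p (e s)) (mdist q (e' t))
 (mdist y (e' t)) (mdist (e' t) p).
move=> xy a l pq b yp C xs A ps qt yt tp' st dA dxs dyt dtp.
move=> t1 t2 t3 t4 t5 t6 t7 pq_ge ps_le qt_le al xya xy0.
(* [C_ge] says that [e s], [q], [y] are almost aligned, since [[y, p]] passes near [q]. [C2], from
   Stewart's inequality and [d(x, y) < d(x, q)], says that the comparison angle at [q] is at most
   right. With both sides at [q] at least [10 d] long, these conflict. *)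
have C_ge : A + b - d * 4 <= C by lra.
have A_ge : d * 10 <= A by lra.
have b_ge : d * 10 <= b by lra.
have C2 : C ^+ 2 <= A ^+ 2 + b ^+ 2.
  have : (1 - s) * xy ^+ 2 <= (1 - s) * l ^+ 2.
    by apply: ler_wpM2l; [|rewrite ler_sqr// ?nnegrE]; lra.
  have : s * b ^+ 2 <= 1 * b ^+ 2 by apply: ler_wpM2r; rewrite ?sqr_ge0//; lra.
  rewrite dA exprMn; lra.
have : (A + b - d * 4) ^+ 2 <= C ^+ 2 by rewrite ler_sqr ?nnegrE; lra.
have : (d * 10) * A <= b * A by apply: ler_wpM2r; lra.
have : (d * 10) * b <= A * b by apply: ler_wpM2r; lra.
have : 0 < d * A by apply: mulr_gt0; lra.
have : 0 < d * b by apply: mulr_gt0; lra.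
have : 0 < d * d by apply: mulr_gt0.
nra.
Qed.

End concatenation.

Section slimness.
Context {X Y : metricType R} (f : X -> Y) (g : Y -> X).
Variables (c : ray X) (c' : ray Y).

Definition fellow_rays E : Prop :=
  (forall u, 0 <= u -> near_ray E c (g (c' u))) /\
  (forall t, 0 <= t -> near_ray E c' (f (c t))).

(** [f] sends the projection of [g y] to within [E] of [c'], so if [g y] were close to [c], then [y]
    would be close to [c']. *)
Lemma fellow_far E L (y : Y) (t : R) : coarse_inverse L f g -> fellow_rays E ->
    (forall v, 0 <= v -> t <= mdist y (c' v)) ->
  t - (L * 2 + E) <= L * mdist (g y) (proj c (g y)).
Proof.
move=> [L1 fL gL gf fg] [_ fE] yfar.
have [s s0 [sE _]] := projP c (g y); rewrite sE.
have [v v0 vE] := fE s s0.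
have := yfar v v0; have := fg y; have := fL (g y) (c s).
have := metric_triangle y (f (g y)) (c' v).
have := metric_triangle (f (g y)) (f (c s)) (c' v).
rewrite (metric_sym y (f (g y))); lra.
Qed.

End slimness.

Lemma fellow_slim L D E : 0 <= D -> 0 <= E -> exists2 d, 0 < d &
  forall (X Y : metricType R) (f : X -> Y) (g : Y -> X) (c : ray X) (c' : ray Y),
    CAT0 Y -> coarse_inverse L f g -> D_contracting D c ->
    fellow_rays f g c c' E -> slim d c'.
Proof.
move=> D0 E0; have [M M0 HM] := morse L D0 E0.
(* [[ps, zs]] will be cut into [m] pieces. If [h > H1], their images under [g] are short enough for
   the contraction property; [h > H2] contradicts the final estimate. *)
pose m := (Num.truncn (L ^+ 4 * 16)).+1.
pose H1 := L ^+ 2 * 16 * (L ^+ 2 + L * 2 + E).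
pose H2 := L * 2 * (3 + L * 4 + E + M + m%:R * D).
exists (`|H1| + `|H2| + 1) => [|X Y f g c c' Y0 fg cD fel x v e v0 exq].
  by have := normr_ge0 H1; have := normr_ge0 H2; lra.
have [L1 _ gL _ _] := fg.
have L0 : 0 < L by lra.
set q := c' v in exq; have [tp tp0 [pE xmin]] := projP c' x.
set p := proj c' x in pE xmin *.
have [s0 s01 smin] := nearest_on_segment p exq; exists s0 => //.
set z := e s0 in smin *; set h := mdist p z; set a := mdist x p.
rewrite leNgt; apply/negP => hbig.
have hH1 : H1 < h.
  by have := ler_norm H1; have := normr_ge0 H2; lra.
have hH2 : H2 < h.
  by have := ler_norm H2; have := normr_ge0 H1; lra.
have h0 : 0 < h.
  by have := normr_ge0 H2; have := normr_ge0 H1; lra.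
have ha : h <= a.
  have [e0 _ _] := exq; rewrite /a metric_sym -[in leRHS]e0.
  by apply: smin; rewrite lexx ler01.
have a0 : 0 < a by lra.
have zM : near_ray M c (g z).
  have [cpz cpzP] := Y0.1 p z.
  have [|b [bq b0 bT bz]] := concat_quasi_geodesic cpzP (geodesic_segment_tail exq s01).
    move=> s s_01; apply: smin.
    have : 0 <= s * (1 - s0) <= 1 * (1 - s0).
      by rewrite mulr_ge0 ?ler_wpM2r//; lra.
    by lra.
  rewrite -bz; apply: (HM _ _ f g c b _ fg cD _ bq).
  - by rewrite addr_ge0// mdist_ge0.
  - by rewrite b0 pE; exact: fel.1.
  - by rewrite bT; exact: fel.1.
  - by rewrite mdist_ge0 lerDl mdist_ge0.
(* The detours from [p] to [ps] and from [z] to [zs], seen through [g], contribute [4 L^2 t = h / 2]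
   to the final estimate of [h]. *)
pose t := h / (L ^+ 2 * 8).
have L2 : 0 < L ^+ 2 * 8 by rewrite mulr_gt0// exprn_gt0.
have L2_1 : 1 <= L ^+ 2 by rewrite exprn_ege1.
have t0 : 0 < t by rewrite divr_gt0.
have th : t <= h by rewrite ler_pdivrMr// ler_peMr//; lra.
(* The same proportion is used on [[p, x]] and [[z, x]], so that [CAT0_cofan] bounds [d(ps, zs)]. *)
pose s := t / a.
have sa : s * a = t by rewrite divfK// gt_eqF.
have s_01 : 0 <= s <= 1.
  rewrite /s divr_ge0 ?(ltW t0) ?(ltW a0)//= ler_pdivrMr// mul1r.
  exact: le_trans th ha.
have [k1 k1P] := Y0.1 p x.
have k2P := geodesic_segment_rev (geodesic_segment_sub exq s01).
set k2 := (fun _ => _) in k2P.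
have zx_le : mdist z x <= a.
  rewrite /a metric_sym metric_sym (metric_sym x p).
  apply: CAT0_obtuse Y0 k2P _ => r r01; rewrite -/z /k2; apply: smin.
  have : 0 <= (1 - r) * s0 <= (1 - r) * 1.
    by rewrite mulr_ge0 ?ler_wpM2l//; lra.
  by lra.
set ps := k1 s; set zs := k2 s.
have ps_p : mdist p ps = t.
  by rewrite (geodesic_segment_dist_start k1P s_01) metric_sym.
have zs_z : mdist z zs <= t.
  rewrite (geodesic_segment_dist_start k2P s_01) -sa ler_wpM2l//; lra.
have ps_x : mdist x ps = a - t.
  rewrite metric_sym (geodesic_segment_dist_end k1P s_01) metric_sym -/a.
  by rewrite mulrBl mul1r sa.
have zs_x : mdist x zs <= a - t.
  rewrite metric_sym (geodesic_segment_dist_end k2P s_01) -sa.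
  have : (1 - s) * mdist z x <= (1 - s) * a by apply: ler_wpM2l => //; lra.
  lra.
have pszs : mdist ps zs <= h.
  apply: le_trans (CAT0_cofan Y0 k1P k2P s_01) _.
  by rewrite ler_piMl ?mdist_ge0//; lra.
have [w wP] := Y0.1 ps zs.
have m0 : 0 < m%:R :> R by rewrite ltr0n.
pose W (i : nat) := w (i%:R / m%:R).
have i01 (i : nat) : (i <= m)%N -> 0 <= i%:R / m%:R :> R /\ i%:R / m%:R <= 1 :> R.
  by move=> im; rewrite divr_ge0 ?ler_pdivrMr// mul1r ler_nat.
have Wfar (i : nat) : (i <= m)%N -> forall u, 0 <= u -> t <= mdist (W i) (c' u).
  move=> im u u0.
  have : mdist x (W i) <= a - t.
    apply: CAT0_dist_convex Y0 wP _ _ zs_x; last by rewrite ps_x.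
    by apply/andP; exact: i01.
  have := xmin u u0; have := metric_triangle x (W i) (c' u); rewrite -/a; lra.
have Wstep (i : nat) : (i < m)%N -> mdist (W i) (W i.+1) <= h / m%:R.
  move=> im; have [_ _ wE] := wP.
  rewrite wE; [|by apply/andP/i01/ltnW|by apply/andP/i01].
  rewrite distrC -mulrBl -natrB// subSnn mul1r ger0_norm ?invr_ge0//.
  by rewrite mulrC ler_wpM2r// invr_ge0.
have hm : L ^+ 2 * (h / m%:R) <= h / (L ^+ 2 * 16).
  have L16 : 0 < L ^+ 2 * 16 by rewrite mulr_gt0// exprn_gt0.
  rewrite ler_pdivlMr//.
  have -> : L ^+ 2 * (h / m%:R) * (L ^+ 2 * 16) = h * (L ^+ 4 * 16 / m%:R).
    by field; rewrite gt_eqF.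
  rewrite ler_piMr ?ltW// ltr_pdivrMr// mul1r.
  have /truncn_itv/andP[_] // : 0 <= L ^+ 4 * 16.
  by rewrite mulr_ge0// exprn_ge0// ltW.
have tE : t = h / (L ^+ 2 * 16) * 2 by rewrite /t; field; rewrite gt_eqF.
have hH1' : L ^+ 2 + L * 2 + E < h / (L ^+ 2 * 16).
  rewrite ltr_pdivlMr; last by rewrite mulr_gt0// exprn_gt0.
  by rewrite mulrC.
(* The projection to [c] moves by at most [m * D] between [g ps] and [g zs], a bound independent of
   [h]. *)
have gpath := @contracting_path _ _ D c (fun i => g (W i)) m cD.
have {}gpath : mdist (proj c (g ps)) (proj c (g zs)) <= m%:R * D.
  have [w0 w1 _] := wP.
  rewrite /W mul0r divff ?gt_eqF// w0 w1 in gpath; apply: gpath => i im; left.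
  have := fellow_far fg fel (Wfar i (ltnW im)); rewrite -/(W i) -/(W i.+1) => far.
  rewrite -(ltr_pM2l L0); apply: lt_le_trans far.
  have g1 : L * mdist (g (W i)) (g (W i.+1)) <= L * (L * (h / m%:R) + L).
    rewrite ler_pM2l//; apply: le_trans (gL _ _) _; rewrite lerD2r ler_pM2l//.
    exact: Wstep.
  apply: le_lt_trans g1 _; rewrite mulrDr !mulrA -!expr2.
  move: hm; rewrite !mulrA => hm; lra.
have pE' : near_ray E c (g p) by rewrite pE; exact: fel.1.
have close (y y' : Y) E' : near_ray E' c (g y) -> mdist y y' <= t ->
    mdist (g y) (proj c (g y')) <= L * t * 2 + L * 2 + E'.
  move=> yE' yt.
  have yy' : mdist (g y) (g y') <= L * t + L.
    by apply: le_trans (gL _ _) _; rewrite lerD2r ler_pM2l.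
  have /near_ray_proj : near_ray (L * t + L + E') c (g y').
    by apply: near_ray_close yE' _; lra.
  have := metric_triangle (g y) (g y') (proj c (g y')); lra.
have c1 : mdist (g p) (proj c (g ps)) <= L * t * 2 + L * 2 + E.
  by apply: close => //; rewrite ps_p.
have c2 := close z zs M zM zs_z.
have low := coarse_inverse_lower p z fg; rewrite -/h in low.
have tri1 := metric_triangle (g p) (proj c (g ps)) (g z).
have tri2 := metric_triangle (proj c (g ps)) (proj c (g zs)) (g z).
rewrite (metric_sym (proj c (g zs)) (g z)) in tri2.
have LtE : L * (L * t) * 8 = h by rewrite /t; field; rewrite gt_eqF.
have : L * mdist (g p) (g z) <=
    L * (L * t * 4 + L * 4 + E + M + m%:R * D).
  by rewrite ler_pM2l//; lra.
move: hH2; rewrite /H2; lra.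
Qed.

End contraction_transfer.

(** * Limit rays *)

Section transfer.
Context {R : realType}.
Implicit Types L D E T K : R.

Lemma arc_segment (X : metricType R) (c : R -> X) x y l :
    geodesic_segment c x y -> 0 <= l <= mdist x y ->
  geodesic_segment (fun s => arc c x y (s * l)) x (arc c x y l).
Proof.
move=> cxy ll; split; rewrite ?mul0r ?mul1r ?arc_start// => s t s01 t01.
have l0 : 0 <= l by lra.
have le_l (r : R) : 0 <= r <= 1 -> 0 <= r * l <= mdist x y.
  move=> r01; have : r * l <= 1 * l by apply: ler_wpM2r; lra.
  by rewrite mulr_ge0//; lra.
by rewrite (arc_isom cxy) ?le_l// -mulrBl normrM (ger0_norm l0) arc_dist_start.
Qed.

(** Two of the segments are [2 N]-close at the length of the shorter one. By the fan inequality they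
    are at most [u / T * 2 N] apart at time [u] once both are longer than [T], so the points at time
    [u] form a Cauchy sequence. *)
Lemma limit_ray (X : metricType R) (y0 : X) (z : nat -> X) (k : nat -> R -> X) (N : R) :
    CAT0 X -> complete_space X -> 0 <= N ->
    (forall n, geodesic_segment (k n) y0 (z n)) ->
    (forall T, exists n0, forall n, (n0 <= n)%N -> T <= mdist y0 (z n)) ->
    (forall m n, (m <= n)%N -> exists2 u, 0 <= u <= mdist y0 (z n) &
       mdist (z m) (arc (k n) y0 (z n) u) <= N) ->
  exists c : ray X, [/\ c 0 = y0, forall n, near_ray (N * 2 + 1) c (z n) &
    forall u e, 0 <= u -> 0 < e -> exists n0, forall n, (n0 <= n)%N ->
      u <= mdist y0 (z n) /\ mdist (c u) (arc (k n) y0 (z n) u) < e].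
Proof.
move=> X0 Xc N0 kP far near; pose l n := mdist y0 (z n).
pose h n := arc (k n) y0 (z n).
have hE n : h n (l n) = z n := arc_end (kP n).
have hz m n : (m <= n)%N -> l m <= l n -> mdist (z m) (h n (l m)) <= N * 2.
  move=> mn lmn; have [u ul uN] := near m n mn.
  have := metric_triangle (z m) (h n u) (h n (l m)).
  have := arc_isom (kP n) (u := u) (v := l m) ul; rewrite -/(h n) => ->; last first.
    by rewrite mdist_ge0.
  have d1 := arc_dist_start (kP n) ul.
  have := metric_triangle y0 (z m) (arc (k n) y0 (z n) u).
  have := metric_triangle y0 (arc (k n) y0 (z n) u) (z m).
  rewrite d1 (metric_sym (arc (k n) y0 (z n) u) (z m)) -/(l m) -/(h n u) => t1 t2 t3.
  have : `|u - l m| <= N by rewrite ler_norml; move: uN; rewrite -/(h n u); lra.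
  by move: uN; rewrite -/(h n u); lra.
(* The lengths [l n] need not increase with [n], hence this second case. *)
have hz' m n : (m <= n)%N -> l n <= l m -> mdist (h m (l n)) (z n) <= N * 2.
  move=> mn lnm; have [u ul uN] := near m n mn.
  have d1 := arc_dist_start (kP n) ul.
  have d2 := arc_dist_end (kP n) ul.
  have d3 : mdist (h m (l n)) (z m) = l m - l n.
    by apply: (arc_dist_end (kP m)); rewrite mdist_ge0.
  have := metric_triangle (h m (l n)) (z m) (z n).
  have := metric_triangle (z m) (arc (k n) y0 (z n) u) (z n).
  have := metric_triangle y0 (arc (k n) y0 (z n) u) (z m).
  rewrite (metric_sym (arc (k n) y0 (z n) u) (z m)) -/(l m) d1 d2 d3 -/(l n); lra.
(* Two applications of the fan inequality: from the shorter length down to [T], then from [T] down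
   to [u]. *)
have hC m n T u : (m <= n)%N -> 0 <= u -> u <= T -> 0 < T -> T <= l m -> T <= l n ->
    mdist (h m u) (h n u) <= u / T * (N * 2).
  move=> mn u0 uT T0 Tm Tn.
  have uT01 : 0 <= u / T <= 1 by rewrite divr_ge0 ?ler_pdivrMr ?mul1r// ltW.
  have Tm' : 0 <= T <= mdist y0 (z m) by rewrite ltW.
  have Tn' : 0 <= T <= mdist y0 (z n) by rewrite ltW.
  have := CAT0_fan X0 (arc_segment (kP m) Tm') (arc_segment (kP n) Tn') uT01.
  rewrite divfK ?gt_eqF// => /le_trans; apply; apply: ler_wpM2l.
    by case/andP: uT01.
  have [lmn|/ltW lnm] := leP (l m) (l n).
    have lm0 : 0 <= l m by exact: mdist_ge0.
    have lm_n : 0 <= l m <= mdist y0 (z n) by rewrite lm0.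
    have lm_m : 0 <= l m <= mdist y0 (z m) by rewrite lm0 /l lexx.
    have lmp : 0 < l m by lra.
    have T01 : 0 <= T / l m <= 1 by rewrite divr_ge0 ?ler_pdivrMr ?mul1r// ltW.
    have := CAT0_fan X0 (arc_segment (kP m) lm_m) (arc_segment (kP n) lm_n) T01.
    rewrite divfK ?gt_eqF// -/(h m) -/(h n) hE => /le_trans; apply.
    apply: le_trans (hz m n mn lmn).
    by rewrite ler_piMl ?mdist_ge0//; case/andP: T01.
  have ln0 : 0 <= l n by exact: mdist_ge0.
  have ln_m : 0 <= l n <= mdist y0 (z m) by rewrite ln0.
  have ln_n : 0 <= l n <= mdist y0 (z n) by rewrite ln0 /l lexx.
  have lnp : 0 < l n by lra.
  have T01 : 0 <= T / l n <= 1 by rewrite divr_ge0 ?ler_pdivrMr ?mul1r// ltW.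
  have := CAT0_fan X0 (arc_segment (kP m) ln_m) (arc_segment (kP n) ln_n) T01.
  rewrite divfK ?gt_eqF// -/(h m) -/(h n) hE => /le_trans; apply.
  apply: le_trans (hz' m n mn lnm).
  by rewrite ler_piMl ?mdist_ge0//; case/andP: T01.
have /choice[c cP] (u : R) : exists x, 0 <= u -> forall e, 0 < e ->
    exists n0, forall n, (n0 <= n)%N -> mdist (h n u) x < e.
  have [u0|_] := leP 0 u; last by exists y0.
  suff [x xP] : exists x, forall e, 0 < e ->
    exists n0, forall n, (n0 <= n)%N -> mdist (h n u) x < e by exists x.
  apply: complete_cauchy_seq => // e e0.
  have uNe : 0 <= u * (N * 2) / e by rewrite divr_ge0 ?mulr_ge0// ltW.
  (* Chosen so that [u / T * (N * 2) < e]. *)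
  pose T := u + 1 + u * (N * 2) / e.
  have T0 : 0 < T by rewrite /T; lra.
  have [n0 n0P] := far T; exists n0.
  have main m n : (m <= n)%N -> (n0 <= m)%N -> (n0 <= n)%N ->
      mdist (h m u) (h n u) < e.
    move=> mn n0m n0n.
    apply: le_lt_trans (hC m n T u mn u0 _ T0 (n0P _ n0m) (n0P _ n0n)) _.
      by rewrite /T; lra.
    rewrite mulrAC ltr_pdivrMr// /T !mulrDr (mulrC e (_ / e)) divfK ?gt_eqF//.
    have := mulr_ge0 (ltW e0) u0; lra.
  move=> m n n0m n0n; have [mn|/ltnW nm] := leqP m n; first exact: main.
  by rewrite metric_sym; exact: main.
have cP' u e : 0 <= u -> 0 < e -> exists n0, forall n, (n0 <= n)%N ->
    u <= l n /\ mdist (c u) (h n u) < e.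
  move=> u0 e0; have [n0 n0P] := cP u u0 e e0; have [n1 n1P] := far u.
  exists (maxn n0 n1) => n; rewrite geq_max => /andP[h0 h1]; split; first exact: n1P.
  by rewrite metric_sym; exact: n0P.
have c_isom s t : 0 <= s -> 0 <= t -> mdist (c s) (c t) = `|s - t|.
  move=> s0 t0; apply/eqP; rewrite -subr_eq0 -normr_le0.
  apply/ler_addgt0Pr => e e0; rewrite add0r.
  have [n0 n0P] := cP' s (e / 2) s0 ltac:(lra).
  have [n1 n1P] := cP' t (e / 2) t0 ltac:(lra).
  have [sl sn] := n0P (maxn n0 n1) (leq_maxl _ _).
  have [tl tn] := n1P (maxn n0 n1) (leq_maxr _ _).
  move: (maxn n0 n1) sl sn tl tn => n sl sn tl tn.
  have := arc_isom (kP n) (u := s) (v := t); rewrite -/(h n) -/(l n) s0 t0 => /(_ sl tl) <-.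
  have := metric_triangle (c s) (h n s) (c t).
  have := metric_triangle (h n s) (h n t) (c t).
  have := metric_triangle (h n s) (c s) (h n t).
  have := metric_triangle (c s) (c t) (h n t).
  rewrite (metric_sym (h n t) (c t)) (metric_sym (h n s) (c s)) ler_norml; lra.
exists (Ray c_isom); split => /=.
- apply: mdist_positivity; apply/eqP; rewrite eq_le mdist_ge0 andbT.
  apply/ler_addgt0Pr => e e0; rewrite add0r.
  have [n0 n0P] := cP' 0 e (lexx _) e0; have [_] := n0P n0 (leqnn _).
  by rewrite /h arc_start// => /ltW.
- move=> m; exists (l m); first exact: mdist_ge0.
  have [n0 n0P] := cP' (l m) 1 (mdist_ge0 _ _) ltr01.
  have [lmn mn] := n0P (maxn m n0) (leq_maxr _ _).
  have := hz m _ (leq_maxl _ _) lmn.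
  have := metric_triangle (z m) (h (maxn m n0) (l m)) (c (l m)).
  rewrite (metric_sym (h _ _) (c _)) /=; lra.
- exact: cP'.
Qed.

Lemma geodesic_arc_quasi (X : metricType R) (c : R -> X) x y :
  geodesic_segment c x y -> quasi_geodesic3 (arc c x y) (mdist x y).
Proof.
move=> cxy u v u0 uv vl; rewrite (arc_isom cxy); [|lra..].
by rewrite distrC ger0_norm; (try split); lra.
Qed.

(** The last index with [s i <= t] is suitable: the next value exceeds [t], after a jump of at most
    [J]. *)
Lemma discrete_ivt (s : nat -> R) (p : nat) (T B J t : R) :
    (forall i, (i < p)%N -> s i.+1 - s i <= J) -> s 0%N <= B -> T - s p <= B ->
    J <= B -> (forall i, 0 <= s i) -> 0 <= t <= T ->
  exists2 i, (i <= p)%N & `|t - s i| <= B.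
Proof.
move=> sJ s0 sp JB s_ge tT.
have [t_lt|le_t] := ltP t (s 0%N).
  by exists 0%N => //; rewrite ler_norml; lra.
have ex0 : exists i, (i <= p)%N && (s i <= t) by exists 0%N; rewrite le_t.
have ltp i : (i <= p)%N && (s i <= t) -> (i <= p)%N by case/andP.
case: (ex_maxnP ex0 ltp) => i /andP[ip si] imax; exists i => //.
have [eip|ltip] := eqVneq i p; first by subst p; rewrite ler_norml; lra.
have {ltip}ip' : (i < p)%N by rewrite ltn_neqAle ltip.
have : t < s i.+1.
  by rewrite ltNge; apply/negP => h; have := imax i.+1; rewrite ip' h ltnn => /(_ isT).
have := sJ i ip'; rewrite ler_norml; lra.
Qed.

(** By the Morse property [g] maps the segments from [y0] to [f (c n)] near [c]. Conversely each
    [f (c t)] is near the later segments, so [limit_ray] gives [c']; slimness then makes it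
    contracting. [E] and [D'] are fixed before the rays, for uniformity on strata. *)
Lemma contracting_transfer L D K : 0 <= D -> 0 <= K -> exists E D' : R,
  forall (X Y : metricType R) (f : X -> Y) (g : Y -> X) (c : ray X) (y0 : Y),
    CAT0 Y -> complete_space Y -> coarse_inverse L f g -> D_contracting D c ->
    mdist y0 (f (c 0)) <= K ->
  exists c' : ray Y, [/\ c' 0 = y0, D_contracting D' c' & fellow_rays f g c c' E].
Proof.
move=> D0 K0; pose E1 := `|L * K + L + L|.
have E1_0 : 0 <= E1 by exact: normr_ge0.
have [M M0 HM] := morse L D0 E1_0.
pose B := M * 2 + L * 2 + E1; pose N := L * (M + B) + L + L.
pose E := `|N * 2 + 1 + L + L + (M + L + L)|.
have E0 : 0 <= E by exact: normr_ge0.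
have [d d0 Hd] := fellow_slim L D0 E0.
exists E, (d * 20) => X Y f g c y0 Y0 Yc fg cD y0K.
have [L1 fL gL gf fg_] := fg.
have L0 : 0 < L by lra.
have LK0 : 0 <= L * K by rewrite mulr_ge0// ltW.
have B0 : 0 <= B by rewrite /B; lra.
have N0 : 0 <= N by rewrite /N; have := mulr_ge0 (ltW L0) (addr_ge0 M0 B0); lra.
pose z n := f (c n%:R).
have /choice[k kP] (n : nat) : exists k, geodesic_segment k y0 (z n) := Y0.1 y0 (z n).
have E1E : E1 = L * K + L + L by rewrite /E1 ger0_norm//; lra.
have gy0 : mdist (g y0) (c 0) <= E1.
  have : L * mdist y0 (f (c 0)) <= L * K by rewrite ler_pM2l.
  have := gL y0 (f (c 0)); have := gf (c 0).
  have := metric_triangle (g y0) (g (f (c 0))) (c 0); lra.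
have gz n : mdist (g (z n)) (c n%:R) <= E1 by apply: le_trans (gf _) _; lra.
have hM n u : 0 <= u <= mdist y0 (z n) -> near_ray M c (g (arc (k n) y0 (z n) u)).
  apply: (HM _ _ f g c _ _ fg cD (mdist_ge0 _ _) (geodesic_arc_quasi (kP n))).
    by rewrite arc_start//; exists 0.
  by rewrite arc_end//; exists n%:R.
have far T : exists n0, forall n, (n0 <= n)%N -> T <= mdist y0 (z n).
  exists (Num.truncn (L * (`|T| + K + 3))).+1 => n n0n.
  have /truncn_itv/andP[_ ] : 0 <= L * (`|T| + K + 3).
    by rewrite mulr_ge0// ?(ltW L0)//; have := normr_ge0 T; lra.
  have : (Num.truncn (L * (`|T| + K + 3))).+1%:R <= n%:R :> R by rewrite ler_nat.
  have := coarse_inverse_lower (c 0) (c n%:R) (coarse_inverse_sym fg).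
  rewrite ray_isom// sub0r normrN normr_nat -/(z n) => h1 h2 h3.
  have := metric_triangle (f (c 0)) y0 (z n); rewrite (metric_sym (f (c 0)) y0).
  have : `|T| + K < mdist (f (c 0)) (z n) by rewrite -(ltr_pM2l L0); lra.
  have := ler_norm T; lra.
(* Sample the segment at integer arc lengths and let [s i] be a time at which [c] is near the image
   under [g] of the [i]-th sample. These times run from about 0 to about [n] with bounded jumps, so
   one of them is near [t]. *)
have near t n : 0 <= t <= n%:R -> exists2 u, 0 <= u <= mdist y0 (z n) &
    mdist (f (c t)) (arc (k n) y0 (z n) u) <= N.
  move=> tn; set l := mdist y0 (z n).
  have l0 : 0 <= l by exact: mdist_ge0.
  pose T (i : nat) := Num.min i%:R l.
  pose h := arc (k n) y0 (z n).
  have TP i : 0 <= T i <= l by rewrite /T le_min ler0n l0 ge_min lexx orbT.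
  have /choice[s sP] (i : nat) : exists s, 0 <= s /\ mdist (g (h (T i))) (c s) <= M.
    by have [s] := hM n (T i) (TP i); exists s.
  pose p := (Num.truncn l).+1.
  have Tp : T p = l.
    by rewrite /T min_r//; have /truncn_itv/andP[_ /ltW] := l0.
  have T0 : T 0%N = 0 by rewrite /T min_l.
  have := @discrete_ivt s p n%:R B (M * 2 + L * 2) t.
  move=> [|||||//|i ip ti].
  - move=> i _; have : mdist (h (T i)) (h (T i.+1)) <= 1.
      rewrite (arc_isom (kP n)) ?TP// ler_norml /T /Num.min -natr1.
      case: ltP => ?; case: ltP => ?; lra.
    move=> /(ler_wpM2l (ltW L0)) => h1.
    have := gL (h (T i)) (h (T i.+1)).
    have [si0 sM] := sP i; have [si0' sM'] := sP i.+1.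
    have := metric_triangle (c (s i)) (g (h (T i))) (c (s i.+1)).
    have := metric_triangle (g (h (T i))) (g (h (T i.+1))) (c (s i.+1)).
    rewrite (metric_sym (c (s i)) (g (h (T i)))) ray_isom//.
    have := ler_norm (s i.+1 - s i); rewrite distrC; lra.
  - have [s0 sM] := sP 0%N.
    have := metric_triangle (c 0) (g y0) (c (s 0%N)).
    move: sM; rewrite T0 /h arc_start// (metric_sym (c 0) (g y0)) ray_isom//.
    by rewrite sub0r normrN ger0_norm// /B; lra.
  - have [s0 sM] := sP p.
    have := metric_triangle (c n%:R) (g (z n)) (c (s p)).
    move: sM; rewrite Tp /h arc_end// (metric_sym (c n%:R) (g (z n))) ray_isom//.
    by have := gz n; have := ler_norm (n%:R - s p); rewrite /B; lra.
  - by rewrite /B; lra.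
  - by move=> i; have [] := sP i.
  exists (T i); first exact: TP.
  have [s0 sM] := sP i.
  have : mdist (c t) (g (h (T i))) <= M + B.
    have := metric_triangle (c t) (c (s i)) (g (h (T i))).
    by rewrite ray_isom//; [rewrite (metric_sym (c (s i)))|case/andP: tn]; lra.
  move=> /(ler_wpM2l (ltW L0)).
  have := fL (c t) (g (h (T i))); have := fg_ (h (T i)).
  have := metric_triangle (f (c t)) (f (g (h (T i)))) (h (T i)).
  rewrite -/(h (T i)) /N; lra.
have near' m n : (m <= n)%N -> exists2 u, 0 <= u <= mdist y0 (z n) &
    mdist (z m) (arc (k n) y0 (z n) u) <= N.
  by move=> mn; apply: near; rewrite ler0n ler_nat.
have [c' [c'0 c'z c'lim]] := limit_ray Y0 Yc N0 kP far near'.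
have fel : fellow_rays f g c c' E.
  split=> [u u0|t t0].
    have [n0 n0P] := c'lim u 1 u0 ltr01; have [un un'] := n0P n0 (leqnn _).
    have uu : 0 <= u <= mdist y0 (z n0) by rewrite u0.
    apply: near_ray_close (hM n0 u uu) _.
    have := gL (arc (k n0) y0 (z n0) u) (c' u); rewrite metric_sym in un'.
    have := ler_wpM2l (ltW L0) (ltW un').
    by have := ler_norm (N * 2 + 1 + L + L + (M + L + L)); rewrite -/E; lra.
  have /andP[tn nt] := truncn_itv t0.
  apply: near_ray_close (c'z (Num.truncn t)) _; rewrite /z.
  have := fL (c (Num.truncn t)%:R) (c t).
  have : mdist (c (Num.truncn t)%:R) (c t) <= 1.
    by rewrite ray_isom// distrC ger0_norm; rewrite -natr1 in nt; lra.
  move=> /(ler_wpM2l (ltW L0)).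
  by have := ler_norm (N * 2 + 1 + L + L + (M + L + L)); rewrite -/E; lra.
exists c'; split => //; apply: slim_contracting => //.
exact: Hd Y0 fg cD fel.
Qed.

End transfer.

(** * The boundary map *)

Section boundary_map.
Context {R : realType}.
Implicit Types L D E T K N : R.

Definition shadows (X Y : metricType R) (f : X -> Y) (c : ray X) (c' : ray Y) :=
  exists N, forall t, 0 <= t -> near_ray N c' (f (c t)).

(** If [b u] is near [a t], then [u] and [t] differ by a bounded amount, being distances to the two
    origins. *)
Lemma shadows_id (X : metricType R) (a b : ray X) : shadows id a b -> asymptotic a b.
Proof.
move=> [N ab]; apply/asboolP; exists (N * 2 + mdist (a 0) (b 0)) => t t0.
have [u u0 uN] := ab t t0.
have := metric_triangle (a t) (b u) (b t).
have := metric_triangle (a 0) (b 0) (b u); have := metric_triangle (a 0) (b u) (a t).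
have := metric_triangle (b 0) (a 0) (b u); have := metric_triangle (a 0) (a t) (b u).
rewrite (metric_sym (b u) (a t)) (metric_sym (b 0) (a 0)) !ray_isom//.
rewrite !sub0r !normrN !(ger0_norm t0, ger0_norm u0) => h1 h2 h3 h4.
have : `|u - t| <= N + mdist (a 0) (b 0) by rewrite ler_norml; lra.
lra.
Qed.

Lemma shadows_comp (X Y Z : metricType R) (f : X -> Y) (g : Y -> Z) L
    (a : ray X) (b : ray Y) (c : ray Z) : 0 <= L -> coarse_lipschitz L g ->
  shadows f a b -> shadows g b c -> shadows (g \o f) a c.
Proof.
move=> L0 gL [N ab] [M bc]; exists (L * N + L + M) => t t0.
have [u u0 uN] := ab t t0; apply: near_ray_close (bc u u0) _ => /=.
rewrite metric_sym; have := gL (f (a t)) (b u); have := ler_wpM2l L0 uN; lra.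
Qed.

Lemma shadows_close (X Y : metricType R) (f f' : X -> Y) (a : ray X) (b : ray Y) M :
  (forall x, mdist (f x) (f' x) <= M) -> shadows f a b -> shadows f' a b.
Proof.
move=> ff' [N ab]; exists (M + N) => t t0.
by apply: near_ray_close (ab t t0) _; rewrite lerD2r.
Qed.

Lemma asymptotic_shadows (X : metricType R) (a b : ray X) :
  asymptotic a b -> shadows id a b.
Proof. by move=> /asboolP[K abK]; exists K => t t0; exists t => //; exact: abK. Qed.

Lemma shadows_asymptotic (X Y : metricType R) (f : X -> Y) L (a a' : ray X)
    (b b' : ray Y) : 0 <= L -> coarse_lipschitz L f ->
  asymptotic a' a -> asymptotic b b' -> shadows f a b -> shadows f a' b'.
Proof.
move=> L0 fL /asymptotic_shadows aa' /asymptotic_shadows bb' ab.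
have id1 : coarse_lipschitz 1 (@id Y) by move=> x y; rewrite mul1r lerDl.
exact: shadows_comp ler01 id1 (shadows_comp L0 fL aa' ab) bb'.
Qed.

(** The rays [a'] and [c'] pass near each other at times [u] and [v], which differ by a bounded
    amount, so time [v] serves for both; it is late because [f (c T)] is far from [f (c 0)]. The
    case [a = c] gives uniqueness of the image ray up to asymptoty, the general case continuity. *)
Lemma shadows_meet (X Y : metricType R) (f : X -> Y) (g : Y -> X) L N K U T
    (a c : ray X) (a' c' : ray Y) : coarse_inverse L f g ->
    mdist (c' 0) (f (c 0)) <= K -> 0 <= T -> L * (U + K + N) + L * 3 <= T ->
    mdist (a T) (c T) <= 1 -> near_ray N a' (f (a T)) -> near_ray N c' (f (c T)) ->
  exists2 u, U <= u & mdist (a' u) (c' u) <= mdist (a' 0) (c' 0) + L * 4 + N * 4.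
Proof.
move=> fg c0K T0 UT aT [u u0 uN] [v v0 vN].
have [L1 fL _ _ _] := fg; have L0 : 0 < L by lra.
have := coarse_inverse_lower (c 0) (c T) (coarse_inverse_sym fg).
rewrite ray_isom// sub0r normrN ger0_norm// => h1.
have h2 : mdist (f (c 0)) (f (c T)) <= v + K + N.
  have := metric_triangle (f (c 0)) (c' 0) (f (c T)).
  have := metric_triangle (c' 0) (c' v) (f (c T)).
  rewrite (metric_sym (f (c 0)) (c' 0)) (metric_sym (c' v) (f (c T))) ray_isom//.
  rewrite sub0r normrN ger0_norm//; lra.
exists v.
  by rewrite -(ler_pM2l L0); have := ler_wpM2l (ltW L0) h2; lra.
have h3 := fL (a T) (c T); have h4 := ler_wpM2l (ltW L0) aT.
have h5 : mdist (a' u) (c' v) <= L * 2 + N * 2.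
  have := metric_triangle (a' u) (f (a T)) (c' v).
  have := metric_triangle (f (a T)) (f (c T)) (c' v).
  rewrite (metric_sym (a' u) (f (a T))); lra.
have := metric_triangle (a' v) (a' u) (c' v).
have := metric_triangle (a' 0) (a' u) (c' v).
have := metric_triangle (c' 0) (a' 0) (c' v).
have := metric_triangle (a' 0) (c' v) (a' u).
have := metric_triangle (a' 0) (c' 0) (c' v).
rewrite (metric_sym (c' v) (a' u)) (metric_sym (c' 0) (a' 0)) !ray_isom//.
rewrite !sub0r !normrN !(ger0_norm v0, ger0_norm u0) => g1 g2 g3 g4.
have : `|v - u| <= mdist (a' 0) (c' 0) + (L * 2 + N * 2) by rewrite ler_norml; lra.
lra.
Qed.

Lemma near_ray_le (X : metricType R) (c : ray X) N N' x : N <= N' ->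
  near_ray N c x -> near_ray N' c x.
Proof. by move=> NN' [s s0 sN]; exists s => //; exact: le_trans sN NN'. Qed.

Lemma shadows_unique (X Y : metricType R) (f : X -> Y) (g : Y -> X) L
    (c : ray X) (a b : ray Y) : CAT0 Y -> coarse_inverse L f g ->
  shadows f c a -> shadows f c b -> asymptotic a b.
Proof.
move=> Y0 fg [N ca] [M cb].
pose P := Num.max N M; pose K := mdist (b 0) (f (c 0)).
apply: (@asymptotic_unbounded _ _ a b (mdist (a 0) (b 0) + L * 4 + P * 4)) => // U.
pose T := `|L * (U + K + P) + L * 3|.
have T0 : 0 <= T by exact: normr_ge0.
apply: (@shadows_meet _ _ f g L P K U T c c) => //.
- exact: ler_norm.
- by rewrite mdistxx.
- by apply: near_ray_le (ca T T0); rewrite le_max lexx.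
- by apply: near_ray_le (cb T T0); rewrite le_max lexx orbT.
Qed.

Lemma D_contracting_le (X : metricType R) (c : ray X) D D' : D <= D' ->
  D_contracting D c -> D_contracting D' c.
Proof. by move=> DD' cD x y /cD/lt_le_trans; apply. Qed.

Lemma contracting_nat (X : metricType R) (c : ray X) :
  contracting c -> exists n : nat, D_contracting n%:R c.
Proof.
move=> [D cD]; exists (Num.truncn `|D|).+1; apply: D_contracting_le cD.
have /andP[_ /ltW] := truncn_itv (normr_ge0 D).
by apply: le_trans; exact: ler_norm.
Qed.

Section map.
Context {X Y : metricType R} (f : X -> Y) (g : Y -> X) (L : R).
Hypotheses (X0 : CAT0 X) (Y0 : CAT0 Y) (Yc : complete_space Y).
Hypothesis fg : coarse_inverse L f g.

(** The graph of the boundary map: a value exists at contracting points, and its uniqueness holds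
    everywhere. *)
Definition boundary_rel (xi : boundary X) (eta : boundary Y) : Prop :=
  exists c c', [/\ endpoint c = xi, endpoint c' = eta & shadows f c c'].

Let L0 : 0 <= L. Proof. by have [] := fg; lra. Qed.
Let fL : coarse_lipschitz L f. Proof. by have [] := fg. Qed.

Lemma boundary_relP (c : ray X) (c' : ray Y) :
  boundary_rel (endpoint c) (endpoint c') <-> shadows f c c'.
Proof.
split=> [[b [b' [/endpointP bc /endpointP bc' bb']]]|cc']; last by exists c, c'.
by apply: shadows_asymptotic L0 fL _ bc' bb'; rewrite asymptotic_sym.
Qed.

Lemma boundary_rel_fun xi eta eta' :
  boundary_rel xi eta -> boundary_rel xi eta' -> eta = eta'.
Proof.
move=> [c [c' [<- <- cc']]].
have [b <-] := endpoint_surj eta' => /boundary_relP cb.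
by apply/endpointP; exact: shadows_unique Y0 fg cc' cb.
Qed.

Lemma boundary_rel_total (xi : boundary X) (y0 : Y) : xi \in contracting_points ->
  exists2 eta, eta \in contracting_points & boundary_rel xi eta.
Proof.
move=> /set_mem[c /contracting_nat[n cn] <-].
have [E [D' tr]] := contracting_transfer L (ler0n R n) (mdist_ge0 y0 (f (c 0))).
have [c' [_ cD' [_ cc']]] := tr X Y f g c y0 Y0 Yc fg cn (lexx _).
exists (endpoint c'); first by apply/mem_set; exists c' => //; exists D'.
by apply/boundary_relP; exists E.
Qed.

Lemma stratum_map (x0 : X) (y0 : Y) (n : nat) : exists N (m : nat),
  forall c : ray X, c 0 = x0 -> D_contracting n%:R c ->
  exists c' : ray Y, [/\ c' 0 = y0, D_contracting m%:R c' &
    forall t, 0 <= t -> near_ray N c' (f (c t))].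
Proof.
have [E [D' tr]] := contracting_transfer L (ler0n R n) (mdist_ge0 y0 (f x0)).
exists E, (Num.truncn `|D'|).+1 => c c0 cn.
have := tr X Y f g c y0 Y0 Yc fg cn; rewrite c0 lexx => /(_ isT).
move=> [c' [c'0 cD' [_ cc']]]; exists c'; split => //.
apply: D_contracting_le cD'; have /andP[_ /ltW] := truncn_itv (normr_ge0 D').
by apply: le_trans; exact: ler_norm.
Qed.

(** By [shadows_meet] the image rays are at bounded distance at some time past [U]; having the same
    origin, they are [e]-close up to time [r] by convexity. *)
Lemma rays_close_uniformly (y0 : Y) N K r e : 0 < r -> 0 < e ->
  exists2 T, 0 <= T & forall (a c : ray X) (a' c' : ray Y),
    a' 0 = y0 -> c' 0 = y0 -> mdist y0 (f (c 0)) <= K ->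
    mdist (a T) (c T) <= 1 -> near_ray N a' (f (a T)) -> near_ray N c' (f (c T)) ->
  forall t, 0 <= t < r -> mdist (a' t) (c' t) < e.
Proof.
(* [U] is at least [r] and satisfies [r * M < e * U]. *)
move=> r0 e0; pose M := `|L * 4 + N * 4|; pose U := r * (M + 1) / e + r.
have M0 : 0 <= M by exact: normr_ge0.
have rM0 : 0 <= r * (M + 1) / e by rewrite divr_ge0 ?mulr_ge0 ?ltW//; lra.
exists (`|L * (U + K + N) + L * 3|) => // a c a' c' a'0 c'0 cK aT nearaT nearcT.
have [|||u Uu] := @shadows_meet _ _ f g L N K U _ a c a' c' fg _ _ _ aT nearaT nearcT.
- by rewrite c'0.
- exact: normr_ge0.
- exact: ler_norm.
rewrite a'0 c'0 mdistxx add0r => uM t /andP[t0 tr].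
have u0 : 0 < u by rewrite /U in Uu; lra.
have tu : 0 <= t <= u by rewrite /U in Uu; lra.
apply: le_lt_trans (ray_dist_convex a' c' Y0 u0 tu) _.
rewrite a'0 c'0 mdistxx add0r mulrAC ltr_pdivrMr//.
apply: le_lt_trans (_ : r * M < _).
  apply: ler_pM => //; [exact: mdist_ge0|exact: ltW|].
  by apply: le_trans uM _; exact: ler_norm.
apply: lt_le_trans (_ : e * U <= _); last by rewrite ler_pM2l.
rewrite /U mulrDr (mulrC e (_ / e)) divfK ?gt_eqF//.
have := mulr_gt0 e0 r0; lra.
Qed.

(** Closedness is checked on one stratum at a time; as [F] maps the [n]-th stratum into the [m]-th,
    a single closed set [C] for [V] is involved. *)
Lemma boundary_map_continuous (x0 : X) (y0 : Y) (F : cboundary x0 -> cboundary y0) :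
  (forall xi, boundary_rel (cboundary_val xi) (cboundary_val (F xi))) ->
  continuous F.
Proof.
move=> FP; apply/continuous_closedP => V /closed_cboundaryP Vc.
apply/closed_cboundaryP => n.
have [N [m nm]] := stratum_map x0 y0 n.
(* No point of the [n]-th stratum whose ray passes within 1 of [c T] at time [T] is sent into [V].
   The union [O] of these neighbourhoods is the open complement sought. *)
pose avoids (T : R) (c : ray X) := forall a : ray X, a 0 = x0 ->
  D_contracting n%:R a -> mdist (a T) (c T) < 1 ->
  forall eta : cboundary x0, cboundary_val eta = endpoint a -> ~ V (F eta).
pose O : set (cone_boundary x0) := [set xi | exists T (c b : ray X),
  [/\ 0 <= T, avoids T c, b 0 = x0, endpoint b = xi & mdist (b T) (c T) < 1]].
have Oo : open O.
  rewrite open_cone_boundaryE => a a0 [T [c [b [T0 avc b0 /endpointP ba bc]]]].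
  have bT : b T = a T by apply: asymptotic_eq => //; rewrite b0 a0.
  (* [T + 1], since [cone_nbhd] controls only times strictly below its radius. *)
  rewrite bT in bc; exists (T + 1), (1 - mdist (a T) (c T)); split; [lra|lra|].
  move=> _ [d [d0 da] <-]; exists T, c, d; split => //; first by rewrite d0.
  have := da T; rewrite T0 ltrDl ltr01 => /(_ isT).
  have := metric_triangle (d T) (a T) (c T); lra.
exists (~` O); first exact: open_closedC.
apply/seteqP; split=> [_ [[eta Veta <-] [a [a0 an] aeta]]|xi [nO Sxi]].
  split; last by exists a.
  move=> [T [c [b [T0 avc b0 bE bc]]]].
  have bT : b T = a T.
    by apply: asymptotic_eq => //; [rewrite b0 a0|apply/endpointP; rewrite bE aeta].
  by rewrite bT in bc; apply: (avc a a0 an bc eta) Veta; rewrite aeta.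
split=> //; have [eta _ etaxi] := contracting_stratum_sub Sxi.
exists eta => //; apply: contrapT => nV; apply: nO.
have [c [c0 cn] cxi] := Sxi.
have [c' [c'0 c'm cc']] := nm c c0 cn.
have FE (d : ray X) (d' : ray Y) (zeta : cboundary x0) :
    cboundary_val zeta = endpoint d -> (forall t, 0 <= t -> near_ray N d' (f (d t))) ->
    cboundary_val (F zeta) = endpoint d'.
  move=> zd dd'; apply: boundary_rel_fun (FP zeta) _; rewrite zd.
  by apply/boundary_relP; exists N.
have [C Cc VC] := Vc m.
have nC : ~ C (endpoint c').
  move=> Cc'; have : (C `&` contracting_stratum y0 m) (endpoint c').
    by split=> //; exists c'.
  rewrite -VC => -[[zeta Vz]]; rewrite -(FE c c' eta)//; last by rewrite etaxi cxi.
  by move=> /cboundary_val_inj zE _; rewrite zE in Vz.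
have := closed_openC Cc; rewrite open_cone_boundaryE => /(_ c' c'0 nC).
move=> [r [e [r0 e0 nbhdC]]].
(* At this [T], every [n]-contracting ray from [x0] within 1 of [c] has its image in the cone
   neighbourhood of [endpoint c'] that misses [C]. *)
have [T T0 TP] := rays_close_uniformly y0 N (mdist y0 (f x0)) r0 e0.
exists T, c, c; rewrite mdistxx; split => // a a0 an ac zeta zE Vz.
have [a' [a'0 a'm aa']] := nm a a0 an.
have : (C `&` contracting_stratum y0 m) (endpoint a').
  by rewrite -VC; split; [exists (F zeta) => //; exact: FE zE aa'|exists a'].
move=> [Ca' _]; apply: (nbhdC (endpoint a')) Ca'.
exists a' => //; split; first by rewrite a'0.
apply: (TP a c) => //.
- by rewrite c0.
- exact: ltW.
- exact: aa'.
- exact: cc'.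
Qed.

End map.

(** [g \o f] is within [L] of the identity, so a ray that shadows [c] through it is asymptotic to
    [c]. *)
Lemma boundary_rel_inv (X Y : metricType R) (f : X -> Y) (g : Y -> X) (L : R)
    xi eta zeta : coarse_inverse L f g ->
  boundary_rel f xi eta -> boundary_rel g eta zeta -> zeta = xi.
Proof.
move=> fg [c [c' [<- <- cc']]].
have [b <-] := endpoint_surj zeta => /(boundary_relP (coarse_inverse_sym fg)) c'b.
have [L1 _ gL gf _] := fg; have L0 : 0 <= L by lra.
apply/esym/endpointP/shadows_id; apply: shadows_close gf _.
exact: shadows_comp L0 gL cc' c'b.
Qed.

Lemma cboundary_homeomorphism (X Y : metricType R) (f : X -> Y) (g : Y -> X) L
    (x0 : X) (y0 : Y) : CAT0 X -> complete_space X -> CAT0 Y -> complete_space Y ->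
  coarse_inverse L f g ->
  exists F : cboundary x0 -> cboundary y0, homeomorphism F /\
    forall xi, boundary_rel f (cboundary_val xi) (cboundary_val (F xi)).
Proof.
move=> X0 Xc Y0 Yc fg; have gf := coarse_inverse_sym fg.
have /choice[F FP] (xi : cboundary x0) : exists eta : cboundary y0,
    boundary_rel f (cboundary_val xi) (cboundary_val eta).
  by have [eta ce xe] := boundary_rel_total Y0 Yc fg y0 (valP xi); exists (SigSub ce).
have /choice[H HP] (xi : cboundary y0) : exists eta : cboundary x0,
    boundary_rel g (cboundary_val xi) (cboundary_val eta).
  by have [eta ce xe] := boundary_rel_total X0 Xc gf x0 (valP xi); exists (SigSub ce).
exists F; split=> //; split; first exact: boundary_map_continuous X0 Y0 Yc fg _ _ _ FP.
exists H; split; last exact: boundary_map_continuous Y0 X0 Xc gf _ _ _ HP.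
  by move=> xi; apply: cboundary_val_inj; exact: boundary_rel_inv fg (FP _) (HP _).
by move=> xi; apply: cboundary_val_inj; exact: boundary_rel_inv gf (HP _) (FP _).
Qed.

End boundary_map.

(** * Orbit maps *)

Section orbits.
Context {R : realType}.
Implicit Types L D E T K N : R.

Lemma seq_bounded (T : eqType) (s : seq T) (u : T -> R) :
  exists2 M, 0 <= M & forall x, x \in s -> u x <= M.
Proof.
elim: s => [|y s [M M0 sM]]; first by exists 0.
exists (Num.max (u y) M); first by rewrite le_max M0 orbT.
move=> x; rewrite inE le_max => /orP[/eqP ->|/sM ->]; first by rewrite lexx.
by rewrite orbT.
Qed.

Lemma seq_bounded_below (T : eqType) (s : seq T) (u : T -> R) :
  (forall x, 0 < u x) -> exists2 M, 0 < M & forall x, x \in s -> M <= u x.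
Proof.
move=> u0; elim: s => [|y s [M M0 sM]]; first by exists 1.
exists (Num.min (u y) M); first by rewrite lt_min M0 u0.
move=> x; rewrite inE ge_min => /orP[/eqP ->|/sM ->]; first by rewrite lexx.
by rewrite orbT.
Qed.

(** Compactness as a near covering property, along the filter of sequences containing a given one;
    near [x], the sequence [[:: x]] suffices. *)
Lemma compact_ball_cover (X : metricType R) (K : set X) (r : X -> R) :
    compact K -> (forall x, 0 < r x) ->
  exists s : seq X, forall x, K x -> exists2 y, y \in s & mdist y x < r y.
Proof.
move=> /compact_near_coveringP Kc r0.
pose F : set_system (seq X) :=
  filter_from [set: seq X] (fun s => [set s' : seq X | {subset s <= s'}]).
have FF : Filter F.
  apply: filter_from_filter; first by exists [::].
  move=> s t _ _; exists (s ++ t) => // s' /= st.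
  by split=> x xs; apply: st; rewrite mem_cat xs ?orbT.
have := Kc _ F (fun s x => exists2 y, y \in s & mdist y x < r y) FF.
move=> /(_ _)[|s _ sP].
  move=> x Kx; exists (ball x (r x), [set s : seq X | {subset [:: x] <= s}]).
    split; first exact: nbhsx_ballx.
    by exists [:: x].
  move=> [y s] [/= xy xs]; exists x; first by apply: xs; rewrite inE.
  by move: xy; rewrite ballEmdist.
by exists s => x; apply: sP.
Qed.

Section one_action.
Context {G : groupType} {X : metricType R} (A : isometric_action G X).

(** Two elements that move points near [x] close to [y] differ by an element that moves a point near
    [y] close to [y]. Properness at [y] leaves finitely many, and finitely many pairs [x], [y] cover
    [K]. *)
Lemma proper_compact (K : set X) : proper_action A -> compact K ->
  exists2 d, 0 < d & finite_set
    [set g : G | exists k k', [/\ K k, K k' & mdist (A g k) k' < d]].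
Proof.
move=> Ap Kc.
have /choice[r rP] (x : X) : exists r, 0 < r /\
    finite_set [set g : G | (A g @` ball x r) `&` ball x r !=set0].
  by have [r r0 rf] := Ap x; exists r.
(* Eighths, because up to four such errors are added below and must stay under [r y]. *)
have [s1 s1P] := compact_ball_cover Kc (r := fun x => r x / 8)
  (fun x => divr_gt0 (rP x).1 (ltr0n _ 8)).
have [e e0 eP] := seq_bounded_below s1 (fun x => (rP x).1).
have e80 : 0 < e / 8 by rewrite divr_gt0.
have [s2 s2P] := compact_ball_cover Kc (r := fun=> e / 8) (fun=> e80).
exists (e / 8) => //.
pose S y x := [set g : G | exists k k', [/\ mdist x k < e / 8,
  mdist y k' < r y / 8 & mdist (A g k) k' < e / 8]].
apply: (@sub_finite_set _ _ (\bigcup_(y in [set` s1]) \bigcup_(x in [set` s2]) S y x)).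
  move=> g [k [k' [Kk Kk' gk]]].
  have [x xs xk] := s2P k Kk; have [y ys yk'] := s1P k' Kk'.
  by exists y => //; exists x => //; exists k, k'.
apply: bigcup_finite; first exact: finite_seq.
move=> y /= ys; apply: bigcup_finite; first exact: finite_seq.
move=> x _; have [->|/set0P[g0 [k0 [k0' [xk0 yk0' g0k0]]]]] := eqVneq (S y x) set0.
  exact: finite_set0.
apply: (@sub_finite_set _ _ ((fun h => h * g0)%g @`
    [set g : G | (A g @` ball y (r y)) `&` ball y (r y) !=set0])); last first.
  by apply: finite_image; exact: (rP y).2.
move=> g [k [k' [xk yk' gk]]]; exists (g * g0^-1)%g; last by rewrite mulgKV.
have ey := eP y ys; have ry := (rP y).1.
exists (A g k0); split.
  exists (A g0 k0); last by rewrite -Defs.actM mulgKV.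
  rewrite ballEmdist /=.
  have := metric_triangle y k0' (A g0 k0); rewrite (metric_sym k0'); lra.
rewrite ballEmdist /=.
have := Defs.act_isom A g k k0.
have := metric_triangle y k' (A g k0); have := metric_triangle k' (A g k) (A g k0).
have := metric_triangle k x k0.
rewrite (metric_sym k x) (metric_sym k' (A g k)); lra.
Qed.

(** [x0] is put into [K] so that orbit points of [x0] are translates of points of [K]. *)
Lemma cocompact_pointed (x0 : X) : cocompact_action A ->
  exists K : set X, [/\ compact K, K x0 & forall x, exists g k, K k /\ A g k = x].
Proof.
move=> [K Kc AK]; exists (K `|` [set x0]); split; last 2 first.
- by right.
- move=> x; have : (\bigcup_(g in [set: G]) (A g @` K)) x by rewrite AK.
  by move=> [g _ [k Kk <-]]; exists g, k; split => //; left.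
by apply: compactU => //; exact: compact_set1.
Qed.

Lemma cocompact_dense_orbit (x0 : X) : cocompact_action A ->
  exists2 r, 0 <= r & forall x, exists g, mdist x (A g x0) <= r.
Proof.
move=> /(cocompact_pointed x0)[K [Kc Kx0 AK]].
have [s sP] := compact_ball_cover Kc (r := fun=> 1) (fun=> ltr01).
have [M M0 MP] := seq_bounded s (fun y => mdist y x0).
exists (M + 1) => [|x]; first by lra.
have [g [k [Kk <-]]] := AK x; exists g; rewrite Defs.act_isom.
have [y ys yk] := sP k Kk; have := MP y ys.
have := metric_triangle k y x0; rewrite (metric_sym k y); lra.
Qed.

End one_action.

(* The Svarc-Milnor argument: the elements of G moving a point of a compact
   fundamental set K close to K are finitely many, and a geodesic from g x0 to
   h x0 cut into short pieces writes g^-1 h as a product of such elements. *)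
Lemma orbit_lipschitz (G : groupType) (X Y : metricType R)
    (A : isometric_action G X) (B : isometric_action G Y) (x0 : X) (y0 : Y) :
    CAT0 X -> proper_action A -> cocompact_action A ->
  exists2 L, 0 <= L & forall g h : G,
    mdist (B g y0) (B h y0) <= L * mdist (A g x0) (A h x0) + L.
Proof.
move=> X0 Ap /(cocompact_pointed x0)[K [Kc Kx0 AK]].
have [d d0 /finite_seqP[s sE]] := proper_compact Ap Kc.
have [M M0 MP] := seq_bounded s (fun g => mdist (B g y0) y0).
have step (g h : G) k k' : K k -> K k' -> mdist (A g k) (A h k') < d ->
    mdist (B g y0) (B h y0) <= M.
  move=> Kk Kk' gh.
  have /MP : (h^-1 * g)%g \in s.
    have : [set` s] (h^-1 * g)%g.
      rewrite -sE; exists k, k'; split=> //.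
      by rewrite -(Defs.act_isom A h) -Defs.actM mulKVg.
    by [].
  by rewrite -(Defs.act_isom B h) -Defs.actM mulKVg.
(* At most [l / d + 1] steps along the segment and one more at each end, each costing at most
   [M]. *)
exists (M / d + M * 3) => [|g h].
  by rewrite addr_ge0 ?divr_ge0 ?mulr_ge0// ltW.
set l := mdist (A g x0) (A h x0).
have l0 : 0 <= l by exact: mdist_ge0.
have [w wP] := X0.1 (A g x0) (A h x0); have [w0 w1 wE] := wP.
pose p := (Num.truncn (l / d)).+1.
have /andP[pl lp] : (Num.truncn (l / d))%:R <= l / d < p%:R.
  by rewrite /p truncn_itv// divr_ge0// ltW.
have p0 : 0 < p%:R :> R by rewrite ltr0n.
pose W (i : nat) := w (i%:R / p%:R).
have i01 (i : nat) : (i <= p)%N -> 0 <= (i%:R / p%:R : R) <= 1.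
  by move=> ip; rewrite divr_ge0 ?ler_pdivrMr// mul1r ler_nat.
have Wstep (i : nat) : (i < p)%N -> mdist (W i) (W i.+1) < d.
  move=> ip; rewrite wE ?i01//; last exact: ltnW.
  rewrite distrC -mulrBl -natrB// subSnn mul1r ger0_norm ?invr_ge0//.
  by rewrite mulrC ltr_pdivrMr// mulrC -ltr_pdivrMr.
have /choice[a aP] (i : nat) : exists a : G, exists2 k, K k & A a k = W i.
  by have [a [k [Kk ak]]] := AK (W i); exists a, k.
have path : mdist (B (a 0%N) y0) (B (a p) y0) <= p%:R * M.
  apply: (@path_length _ _ (fun i => B (a i) y0)) => i ip.
  have [k Kk ak] := aP i; have [k' Kk' ak'] := aP i.+1.
  by apply: step Kk Kk' _; rewrite ak ak'; exact: Wstep.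
have start : mdist (B g y0) (B (a 0%N) y0) <= M.
  have [k Kk ak] := aP 0%N; apply: step Kx0 Kk _.
  by rewrite ak /W mul0r w0 mdistxx.
have end_ : mdist (B (a p) y0) (B h y0) <= M.
  have [k Kk ak] := aP p; apply: step Kk Kx0 _.
  by rewrite ak /W divff ?gt_eqF// w1 mdistxx.
have := metric_triangle (B g y0) (B (a 0%N) y0) (B h y0).
have := metric_triangle (B (a 0%N) y0) (B (a p) y0) (B h y0).
have : p%:R * M <= (l / d + 1) * M.
  by rewrite ler_wpM2r// /p -natr1 lerD2r.
have : 0 <= M / d by rewrite divr_ge0// ltW.
have := mulr_ge0 M0 l0.
rewrite mulrDl mulrAC -mulrA => h1 h2 h3 h4 h5.
have -> : (M / d + M * 3) * l = l * M / d + M * l * 3 by ring.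
rewrite mulrA in h3; lra.
Qed.

(** [f] picks a group element [a x] that moves [x0] near [x] and applies it to [y0]. Equivariance
    fails only through this choice, hence by a bounded amount. *)
Lemma equivariant_coarse_inverse (G : groupType) (X Y : metricType R)
    (A : isometric_action G X) (B : isometric_action G Y) (x0 : X) (y0 : Y) :
    CAT0 X -> CAT0 Y -> proper_action A -> cocompact_action A ->
    proper_action B -> cocompact_action B ->
  exists (f : X -> Y) (g : Y -> X) (L M : R), coarse_inverse L f g /\
    forall a x, mdist (f (A a x)) (B a (f x)) <= M.
Proof.
move=> X0 Y0 Ap Ac Bp Bc.
have [L1 L1_0 AB] := orbit_lipschitz B x0 y0 X0 Ap Ac.
have [L2 L2_0 BA] := orbit_lipschitz A y0 x0 Y0 Bp Bc.
have [r1 r1_0 /choice[a aP]] := cocompact_dense_orbit x0 Ac.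
have [r2 r2_0 /choice[b bP]] := cocompact_dense_orbit y0 Bc.
pose L := L1 + L2 + 1; pose r := r1 + r2.
have L0 : 0 <= L by rewrite /L; lra.
have fwd g h : mdist (B g y0) (B h y0) <= L * mdist (A g x0) (A h x0) + L.
  apply: le_trans (AB g h) _; rewrite lerD//; last by rewrite /L; lra.
  by rewrite ler_wpM2r ?mdist_ge0// /L; lra.
have bwd g h : mdist (A g x0) (A h x0) <= L * mdist (B g y0) (B h y0) + L.
  apply: le_trans (BA g h) _; rewrite lerD//; last by rewrite /L; lra.
  by rewrite ler_wpM2r ?mdist_ge0// /L; lra.
have {}aP x : mdist x (A (a x) x0) <= r by apply: le_trans (aP x) _; rewrite /r; lra.
have {}bP y : mdist y (B (b y) y0) <= r by apply: le_trans (bP y) _; rewrite /r; lra.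
have r0 : 0 <= r by rewrite /r; lra.
have Lr := mulr_ge0 L0 r0.
exists (fun x => B (a x) y0), (fun y => A (b y) x0), (L * (r * 2 + 1) + r).
exists (L * (r * 2) + L); split; first split.
- by rewrite /L in Lr *; lra.
- move=> x x'; apply: le_trans (fwd _ _) _.
  have := metric_triangle (A (a x) x0) x (A (a x') x0).
  have := metric_triangle x x' (A (a x') x0); rewrite (metric_sym (A (a x) x0) x).
  have := aP x; have := aP x' => h1 h2 h3 h4.
  have /(ler_wpM2l L0) : mdist (A (a x) x0) (A (a x') x0) <= mdist x x' + r * 2 by lra.
  have := mulr_ge0 Lr (mdist_ge0 x x'); have := mulr_ge0 r0 (mdist_ge0 x x'); lra.
- move=> y y'; apply: le_trans (bwd _ _) _.
  have := metric_triangle (B (b y) y0) y (B (b y') y0).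
  have := metric_triangle y y' (B (b y') y0); rewrite (metric_sym (B (b y) y0) y).
  have := bP y; have := bP y' => h1 h2 h3 h4.
  have /(ler_wpM2l L0) : mdist (B (b y) y0) (B (b y') y0) <= mdist y y' + r * 2 by lra.
  have := mulr_ge0 Lr (mdist_ge0 y y'); have := mulr_ge0 r0 (mdist_ge0 y y'); lra.
- move=> x; set y := B (a x) y0.
  have := metric_triangle (A (b y) x0) (A (a x) x0) x.
  have := ler_wpM2l L0 (bP y); have := bwd (b y) (a x); have := aP x.
  rewrite -/y (metric_sym (B _ _) y) (metric_sym (A (a x) x0) x); lra.
- move=> y; set x := A (b y) x0.
  have := metric_triangle (B (a x) y0) (B (b y) y0) y.
  have := ler_wpM2l L0 (aP x); have := fwd (a x) (b y); have := bP y.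
  rewrite -/x (metric_sym (A _ _) x) (metric_sym (B (b y) y0) y); lra.
move=> g x; rewrite -Defs.actM; apply: le_trans (fwd _ _) _; rewrite lerD2r ler_wpM2l//.
have := metric_triangle (A (a (A g x)) x0) (A g x) (A (g * a x)%g x0).
have := aP (A g x); rewrite Defs.actM Defs.act_isom (metric_sym _ (A g x)); have := aP x; lra.
Qed.

Lemma shadows_act (G : groupType) (X Y : metricType R)
    (A : isometric_action G X) (B : isometric_action G Y) (f : X -> Y) M
    (g : G) (c : ray X) (c' : ray Y) :
    (forall a x, mdist (f (A a x)) (B a (f x)) <= M) ->
  shadows f c c' -> shadows f (ray_act A g c) (ray_act B g c').
Proof.
move=> fM [N cc']; exists (M + N) => t /cc'[s s0 sN]; exists s => //=.
have := metric_triangle (f (A g (c t))) (B g (f (c t))) (B g (c' s)).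
have := fM g (c t); rewrite Defs.act_isom; lra.
Qed.

End orbits.

Theorem corollary3p11 (R : realType) (G : groupType) (X Y : metricType R)
    (A : isometric_action G X) (B : isometric_action G Y) (x0 : X) (y0 : Y)
    (X_CAT0 : CAT0 X) (X_complete : complete_space X)
    (Y_CAT0 : CAT0 Y) (Y_complete : complete_space Y)
    (A_proper : proper_action A) (A_cocompact : cocompact_action A)
    (B_proper : proper_action B) (B_cocompact : cocompact_action B) :
  exists f : cboundary x0 -> cboundary y0,
    homeomorphism f /\
    (forall (g : G) (xi : cboundary x0),
       f (cboundary_act A g xi) = cboundary_act B g (f xi)).
Proof.
have [f [f' [L [M [ff' fM]]]]] := equivariant_coarse_inverse x0 y0
  X_CAT0 Y_CAT0 A_proper A_cocompact B_proper B_cocompact.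
have [F [Fh FP]] := cboundary_homeomorphism x0 y0
  X_CAT0 X_complete Y_CAT0 Y_complete ff'.
exists F; split=> // g xi; apply: cboundary_val_inj.
(* Uniqueness of the boundary value turns coarse equivariance of [f] into exact equivariance of
   [F]. *)
apply: (boundary_rel_fun Y_CAT0 ff' (FP _)).
have [c [c' [cE c'E cc']]] := FP xi.
have -> : cboundary_val (cboundary_act A g xi) = endpoint (ray_act A g c).
  by rewrite -boundary_act_endpoint cE.
have -> : cboundary_val (cboundary_act B g (F xi)) = endpoint (ray_act B g c').
  by rewrite -boundary_act_endpoint c'E.
by apply/(boundary_relP ff'); exact: shadows_act fM cc'.
Qed.
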